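(* Let $d\geq 2$ and $k\geq 1$ be integers and let $E\subset\mathbb{R}^d$ be a Borel set with $\dim_{\mathrm H}(E)>s>k$. Then $k+1\leq d_E\leq d$, where $d_E$ is the effective dimension of $E$. Moreover, let $V\in\mathcal{A}(d,d_E)$ be an affine subspace of minimal dimension $d_E$ with $\dim_{\mathrm H}(E\setminus V)<\dim_{\mathrm H}(E)$, let $F=E\cap V$, and assume that the following two conditions hold. (1) The incidence set $$\mathcal{S}:=\{(\psi_k(\boldsymbol{x}),\boldsymbol{x}):\boldsymbol{x}\in F^{k+1}\setminus D\}\subset\mathcal{A}(d,k)\times\mathbb{R}^{(k+1)d}$$ has the Fubini property. (2) With $\beta=\dim_{\mathrm H}(\mathcal{P}^k(F))$, $$\operatorname{ess-sup}^{\beta}_{W^{k+1}\in\mathcal{W}^{k+1}(F)}\dim_{\mathrm H}(F^{k+1}\cap W^{k+1})\leq\max\{0,\dim_{\mathrm H}(F^{k+1})-(k+1)(d_E-k)\}.$$ Then (with $1\leq k\leq d_E-1$) $$\dim_{\mathrm H}\mathcal{P}^k(E)\geq\dim_{\mathrm H}\mathcal{P}^k(F)\geq(k+1)\min\{s,d_E-k\}.$$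
   Context: $\dim_{\mathrm H}$ is Hausdorff dimension and $\mathcal{H}^t$ is $t$-dimensional Hausdorff (outer) measure. Affine Grassmannian: $\mathcal{A}(d,m)$ is the set of $m$-dimensional affine subspaces of $\mathbb{R}^d$. Writing $W=W_0+p$ with $W_0$ an $m$-dimensional linear subspace and $p\in W_0^\perp$, it is given its natural metric $\|P_{W_0}-P_{V_0}\|+|p-q|$ for $W=W_0+p$, $V=V_0+q$, where $P_{W_0}$ is the orthogonal projection matrix onto $W_0$. Via $W\mapsto(P_{W_0},p)$ it is regarded as a subset of a Euclidean space $\mathbb{R}^{d^2+d}$. Effective dimension: for $E\subset\mathbb{R}^d$ with $\dim_{\mathrm H}(E)>k$, $$d_E:=\min\{m\in\mathbb{N}:\exists\,V\in\mathcal{A}(d,m)\text{ such that }\dim_{\mathrm H}(E\setminus V)<\dim_{\mathrm H}(E)\},$$ with $\dim_{\mathrm H}(\emptyset)=0$. Spans: for a set $A\subset\mathbb{R}^d$, let $D\subset A^{k+1}$ be the set of affinely dependent tuples $(x_0,\ldots,x_k)\in A^{k+1}$ (here used with $A=F$), and for $\boldsymbol{x}=(x_0,\ldots,x_k)\in A^{k+1}\setminus D$ let $\psi_k(\boldsymbol{x}):=\operatorname{aff}\{x_0,\ldots,x_k\}\in\mathcal{A}(d,k)$ be the affine span. $\mathcal{P}^k(A):=\psi_k(A^{k+1}\setminus D)$ is the set of $k$-planes spanned by $k+1$ affinely independent points of $A$. For $W\in\mathcal{P}^k(A)$, $W^{k+1}=W\times\cdots\times W\subset\mathbb{R}^{d(k+1)}$,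 and $\mathcal{W}^{k+1}(A):=\{W^{k+1}:W\in\mathcal{P}^k(A)\}\subset\mathcal{A}(d(k+1),k(k+1))$; $\dim_{\mathrm H}\mathcal{W}^{k+1}(A)=\dim_{\mathrm H}\mathcal{P}^k(A)$. Essential supremum: for a nonempty set $Z$ in a metric space with $\alpha=\dim_{\mathrm H}(Z)$ and $f:Z\to[0,\infty)$: if $\mathcal{H}^\alpha(Z)>0$, then $$\operatorname{ess-sup}^{\alpha}_{z\in Z}f(z):=\sup\{q\geq 0:\mathcal{H}^{\alpha}(\{z\in Z:f(z)>q\})>0\},$$ with $\sup\emptyset=0$; if $\mathcal{H}^\alpha(Z)=0$, then $$\operatorname{ess-sup}^{\alpha}_{z\in Z}f(z):=\lim_{\varepsilon\to0+}\sup\{q\geq 0:\mathcal{H}^{\alpha-\varepsilon}(\{z\in Z:f(z)>q\})>0\}.$$ Fubini property: a nonempty set $B\subset\mathbb{R}^m\times\mathbb{R}^n$, with $\pi_X$ the orthogonal projection onto the first factor $\mathbb{R}^m$, has the Fubini property if $$\dim_{\mathrm H}(B)=\dim_{\mathrm H}(\pi_X(B))+\operatorname{ess-sup}^{\alpha}_{x\in\pi_X(B)}\dim_{\mathrm H}(\pi_X^{-1}(x)\cap B),\qquad\alpha=\dim_{\mathrm H}(\pi_X(B)).$$ For $\mathcal{S}$, the first factor is (the Euclidean space containing) $\mathcal{A}(d,k)$ and the second factor is $\mathbb{R}^{(k+1)d}$. *)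

(* Defs.v *)
(* MathComp-Analysis, over an arbitrary [R : realType].  R^n is ['rV[R]_n]. *)
From HB Require Import structures.
From mathcomp Require Import all_boot all_order all_algebra.
From mathcomp Require Import all_classical all_reals all_analysis.

Set Implicit Arguments.
Unset Strict Implicit.
Unset Printing Implicit Defensive.

Import Order.TTheory GRing.Theory Num.Theory.
Import numFieldNormedType.Exports.

Local Open Scope classical_set_scope.
Local Open Scope ring_scope.

(* Hausdorff measure and dimension are taken with respect to an explicit
   distance function, because the metric that the library puts on matrices is
   the one of the sup norm. *)
Section Hausdorff.
Local Open Scope ereal_scope.
Context {R : realType} {T : Type}.
Variable dist : T -> T -> R.

(* [-oo] on the empty set *)
Definition diam (A : set T) : \bar R :=
  ereal_sup [set (dist x y)%:E | x in A & y in A].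

(* diam(U)^t, where the empty set contributes 0 even for t = 0, and a nonempty
   set of diameter 0 contributes 0^0 = 1 for t = 0, so that the 0-dimensional
   measure is the counting measure *)
Definition diam_pow (t : R) (U : set T) : \bar R :=
  if U == set0 then 0 else poweR (diam U) t.

Definition hausdorff_pre (t delta : R) (A : set T) : \bar R :=
  ereal_inf [set \sum_(0 <= i <oo) diam_pow t (U i) | U in
    [set U : nat -> set T |
      A `<=` \bigcup_i U i /\ forall i, diam (U i) <= delta%:E]].

Definition hausdorff_measure (t : R) (A : set T) : \bar R :=
  ereal_sup [set hausdorff_pre t delta A | delta in [set delta | (0 < delta)%R]].

Definition hausdorff_dim (A : set T) : \bar R :=
  ereal_inf [set t%:E | t in
    [set t : R | (0 <= t)%R /\ hausdorff_measure t A = 0]].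

(* sup {q >= 0 : H^t({z in Z : f z > q}) > 0}, with sup of the empty set 0 *)
Definition sup_levels (t : R) (Z : set T) (f : T -> \bar R) : \bar R :=
  maxe 0 (ereal_sup [set q%:E | q in [set q : R |
    (0 <= q)%R /\ 0 < hausdorff_measure t [set z | Z z /\ q%:E < f z]]]).

(* [alpha] is the Hausdorff dimension of [Z], as a real number *)
Definition ess_sup_dim (alpha : R) (Z : set T) (f : T -> \bar R) : \bar R :=
  if `[< 0 < hausdorff_measure alpha Z >] then sup_levels alpha Z f
  else lim (sup_levels (alpha - eps) Z f @[eps --> (0 : R)^'+]).

End Hausdorff.

Section Euclidean.
Local Open Scope ereal_scope.
Context {R : realType}.

Definition enorm n (v : 'rV[R]_n) : R := Num.sqrt (\sum_i v ord0 i ^+ 2)%R.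

Definition euclidean_dist n (u v : 'rV[R]_n) : R := enorm (u - v)%R.

Definition dimH n (A : set 'rV[R]_n) : \bar R := hausdorff_dim (@euclidean_dist n) A.

Definition opnorm n (A : 'M[R]_n) : R :=
  sup [set enorm (v *m A) | v in [set v : 'rV[R]_n | (enorm v <= 1)%R]].

Definition borel n : set (set 'rV[R]_n) := <<s [set U | open U] >>.

(* The product R^m x R^n is R^(m + n), with first projection [lsubmx]. *)
Definition fubini_property m n (B : set 'rV[R]_(m + n)) : Prop :=
  let piB := [set lsubmx b | b in B] in
  B !=set0 /\
  dimH B = dimH piB
    + ess_sup_dim (@euclidean_dist m) (fine (dimH piB)) piB
        (fun x => dimH [set b | B b /\ lsubmx b = x]).

End Euclidean.

Section AffineSubspaces.
Context {R : realType}.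

(* W0 + p, where the linear subspace W0 is the row space of [W] *)
Definition flat d (W : 'M[R]_d) (p : 'rV[R]_d) : set 'rV[R]_d :=
  [set x | (x - p <= W)%MS].

Definition affine_grass d m : set (set 'rV[R]_d) :=
  [set V | exists (W : 'M[R]_d) (p : 'rV[R]_d), \rank W = m /\ V = flat W p].

Definition orth_compl d (W : 'M[R]_d) : 'M[R]_d := kermx W^T.

Definition orth_proj d (W : 'M[R]_d) : 'M[R]_d := proj_mx W (orth_compl W).

(* (P_{W0}, p) for V = W0 + p with p orthogonal to W0; this pair is unique when
   V is an affine subspace, and (0, 0) is a junk value otherwise *)
Definition affine_code d (V : set 'rV[R]_d) : 'M[R]_d * 'rV[R]_d :=
  xget (0, 0) [set c | exists W : 'M[R]_d,
    [/\ V = flat W c.2, (c.2 <= orth_compl W)%MS & c.1 = orth_proj W]].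

Definition affine_dist d (V V' : set 'rV[R]_d) : R :=
  opnorm ((affine_code V).1 - (affine_code V').1)
  + enorm ((affine_code V).2 - (affine_code V').2).

Definition affine_embed d (V : set 'rV[R]_d) : 'rV[R]_(d * d + d) :=
  row_mx (mxvec (affine_code V).1) (affine_code V).2.

Definition dimH_affine d (P : set (set 'rV[R]_d)) : \bar R :=
  hausdorff_dim (@affine_dist d) P.

(* The junk value 0 is only used when there is no such m. *)
Definition effective_dim d (E : set 'rV[R]_d) : nat :=
  let drops m := exists V, affine_grass m V /\ (dimH (E `\` V) < dimH E)%E in
  xget 0%N [set m | drops m /\ forall n, drops n -> (m <= n)%N].

End AffineSubspaces.

(* A tuple (x_0, ..., x_k) of points of R^d is a vector of R^((k + 1) d); x_i is
   row i of the matrix [vec_mx x]. *)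
Section Spans.
Context {R : realType} {d k : nat}.

Definition power_set (A : set 'rV[R]_d) : set 'rV[R]_(k.+1 * d) :=
  [set x | forall i : 'I_k.+1, A (row i (vec_mx x))].

Definition affinely_dependent (x : 'rV[R]_(k.+1 * d)) : Prop :=
  exists c : 'rV[R]_k.+1,
    [/\ c != 0, \sum_i c ord0 i = 0 & c *m vec_mx x = 0].

Definition affine_span (x : 'rV[R]_(k.+1 * d)) : set 'rV[R]_d :=
  [set c *m vec_mx x | c in [set c : 'rV[R]_k.+1 | \sum_i c ord0 i = 1]].

Definition independent_tuples (A : set 'rV[R]_d) : set 'rV[R]_(k.+1 * d) :=
  [set x | power_set A x /\ ~ affinely_dependent x].

Definition spanned_planes (A : set 'rV[R]_d) : set (set 'rV[R]_d) :=
  [set affine_span x | x in independent_tuples A].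

Definition spanned_plane_powers (A : set 'rV[R]_d) :
    set (set 'rV[R]_(k.+1 * d)) :=
  [set power_set W | W in spanned_planes A].

Definition incidence_set (A : set 'rV[R]_d) :
    set 'rV[R]_((d * d + d) + k.+1 * d) :=
  [set row_mx (affine_embed (affine_span x)) x | x in independent_tuples A].

End Spans.

Arguments power_set {R d} k A _.
Arguments spanned_planes {R d} k A _.
Arguments spanned_plane_powers {R d} k A _.
Arguments incidence_set {R d} k A _.

(* Main.v *)
Require Import Defs.
From HB Require Import structures.
From mathcomp Require Import all_boot all_order all_algebra.
From mathcomp Require Import all_classical all_reals all_analysis.
From mathcomp Require Import measurable_realfun zify ring lra.
Set Implicit Arguments.
Unset Strict Implicit.
Unset Printing Implicit Defensive.
Import Order.TTheory GRing.Theory Num.Theory.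
Import numFieldNormedType.Exports.
Local Open Scope classical_set_scope.
Local Open Scope ring_scope.
Local Open Scope ereal_scope.

(** Let F be the part of E in V, let P be the set of k-planes spanned by F, and
    let S be the incidence set.  Forgetting the plane maps S onto the affinely
    independent tuples, so dim S is at least the dimension of F^(k+1) minus the
    dependent tuples D.  The fibre of S over a plane W consists of tuples in
    F^(k+1) and W^(k+1), so the Fubini property together with the bound on the
    essential supremum gives

      dim (F^(k+1) - D) <= dim P + max (0, dim F^(k+1) - (k+1) (dE - k)).

    As soon as D may be neglected on the left, this rearranges to
    dim P >= min (dim F^(k+1), (k+1) (dE - k)), and the theorem follows from
    dim F^(k+1) >= (k+1) dim F and dim F = dim E > s.

    Two facts about Hausdorff dimension carry the argument.

    The first is dim (A x B) >= dim A + dim B for arbitrary sets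
    ([net_null_product]).  Hausdorff null sets are the sets with dyadic covers of
    arbitrarily small cost ([net_nullE]), so one works with covers by dyadic
    cells.  A cover of A x B by cells Q x Q' gives every cell Q the weight
    diam (Q')^b.  Over each point of A the total weight exceeds the b-content of
    B, because the cells Q' met there cover B.  Summing the weights along the
    ancestors of a point and stopping where the sum first passes a threshold u
    gives, for each u, an honest cover of A; the average over u of the costs of
    these covers is bounded by the cost of the given cover
    ([threshold_bound]).

    The second is that D is small.  In a dependent tuple one point is a linear
    combination of the k others, so D is contained in k+1 locally Lipschitz
    images of F^k x R^k ([null_dependent]).  A factor R^k adds at most k to the
    dimension ([null_cylinder]), whence
    dim D <= dim F^k + k < dim F^k + dim F <= dim F^(k+1), and removing D does
    not change the dimension ([dimH_independent_tuples]).

    What remains is the passage between the different metrics on spaces of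
    planes.  A plane determines its code, the code of W^(k+1) is the block
    diagonal copy of the code of W ([affine_code_power]), and so both W |-> code
    of W and W |-> W^(k+1) are bi-Lipschitz; such maps preserve null sets, hence
    dimensions and essential suprema ([ess_sup_dim_transfer]).  The bounds on the
    effective dimension hold because an m-plane has dimension at most m
    ([dimH_flat_le]) and dimension is stable under finite unions. *)

(** * Null sets and dimension for an arbitrary distance *)

Section HausdorffNull.
Context {R : realType} {T : Type}.
Variable dist : T -> T -> R.
Hypothesis dist_ge0 : forall x y, (0 <= dist x y)%R.
Implicit Types (A B U : set T) (t : R).
Local Notation diam := (diam dist).
Local Notation diam_pow := (diam_pow dist).
Local Notation H := (hausdorff_measure dist).
Local Notation dim := (hausdorff_dim dist).

Lemma dist_le_diam U x y : U x -> U y -> (dist x y)%:E <= diam U.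
Proof. by move=> Ux Uy; apply: ereal_sup_ubound; exists x => //; exists y. Qed.

Lemma diam_le U (b : \bar R) :
  (forall x y, U x -> U y -> (dist x y)%:E <= b) -> diam U <= b.
Proof. by move=> h; apply: ge_ereal_sup => _ [x Ux [y Uy <-]]; exact: h. Qed.

Lemma diam_ge0 U : U !=set0 -> 0 <= diam U.
Proof.
by move=> [x Ux]; apply: (le_trans _ (dist_le_diam Ux Ux)); rewrite lee_fin.
Qed.

Lemma diam_pow_ge0 t U : 0 <= diam_pow t U.
Proof. by rewrite /Defs.diam_pow; case: ifP => // _; exact: poweR_ge0. Qed.

Lemma diam_pow0 t : diam_pow t set0 = 0.
Proof. by rewrite /Defs.diam_pow eqxx. Qed.

Lemma diam_powE t U : U !=set0 -> diam_pow t U = poweR (diam U) t.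
Proof. by move=> /set0P/negbTE U0; rewrite /Defs.diam_pow U0. Qed.

Lemma hausdorff_pre_ge0 t delta A : 0 <= hausdorff_pre dist t delta A.
Proof.
apply: le_ereal_inf_tmp => _ [U _ <-]; apply: nneseries_ge0 => *.
exact: diam_pow_ge0.
Qed.

Lemma hausdorff_measure_ge0 t A : 0 <= H t A.
Proof.
apply: le_trans (hausdorff_pre_ge0 t 1 A) _.
by apply: ereal_sup_ubound; exists 1%R => //=; rewrite ltr01.
Qed.

Lemma null_coverP t A : H t A = 0 <->
  forall delta e : R, (0 < delta)%R -> (0 < e)%R -> exists U : nat -> set T,
    [/\ A `<=` \bigcup_i U i, forall i, diam (U i) <= delta%:E &
        \sum_(0 <= i <oo) diam_pow t (U i) <= e%:E].
Proof.
split=> [h0 delta e d0 e0|h].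
  have : hausdorff_pre dist t delta A < e%:E.
    apply: (@le_lt_trans _ _ 0); last by rewrite lte_fin.
    by rewrite -h0; apply: ereal_sup_ubound; exists delta.
  by move=> /ereal_inf_lt[_ [U [AU dU] <-] /ltW Ue]; exists U.
apply/eqP; rewrite eq_le hausdorff_measure_ge0 andbT.
apply: ge_ereal_sup => _ [delta /= d0 <-].
apply/lee_addgt0Pr => e e0; rewrite add0e.
have [U [AU dU /(le_trans _)]] := h _ _ d0 e0; apply.
by apply: ereal_inf_lbound; exists U.
Qed.

Lemma hausdorff_measure_le t A B : A `<=` B -> H t A <= H t B.
Proof.
move=> AB; apply: ge_ereal_sup => _ [delta /= d0 <-].
apply: (@le_trans _ _ (hausdorff_pre dist t delta B)); last first.
  by apply: ereal_sup_ubound; exists delta.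
apply: le_ereal_inf_tmp => _ [U [BU dU] <-]; apply: ereal_inf_lbound.
by exists U => //; split => //; exact: subset_trans AB BU.
Qed.

Lemma null_subset t A B : A `<=` B -> H t B = 0 -> H t A = 0.
Proof.
move=> AB h; apply/eqP; rewrite eq_le hausdorff_measure_ge0 andbT -h.
exact: hausdorff_measure_le.
Qed.

Lemma diam_pow_anti t t' U : (0 <= t)%R -> (t <= t')%R -> diam U <= 1 ->
  diam_pow t' U <= diam_pow t U.
Proof.
move=> t0 tt' U1; have [->|/set0P Une] := eqVneq U set0.
  by rewrite !diam_pow0.
rewrite !diam_powE//; have := diam_ge0 Une.
move: U1; case: (diam U) => [x| |] //; rewrite !lee_fin => x1 x0.
have [xe|xn] := eqVneq x 0%R; last first.
  by apply: ger_powR => //; rewrite lt_neqAle eq_sym xn x0.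
rewrite xe; have [t'0|tn] := eqVneq t' 0%R; last by rewrite powR0// powR_ge0.
by rewrite (_ : t = t')//; apply/eqP; rewrite eq_le tt' t'0.
Qed.

(** In a cover whose sets have diameter at most 1, raising the exponent can
    only lower the cost, so it suffices to test small [delta]. *)
Lemma null_anti t t' A : (0 <= t)%R -> (t <= t')%R -> H t A = 0 -> H t' A = 0.
Proof.
move=> t0 tt' /null_coverP h; apply/null_coverP => delta e d0 e0.
have [|U [AU dU Ue]] := h (Num.min delta 1%R) e _ e0.
  by rewrite lt_min d0 ltr01.
exists U; split => //.
  by move=> i; apply: le_trans (dU i) _; rewrite lee_fin ge_min lexx.
apply: le_trans Ue; apply: lee_nneseries => [*|i _]; first exact: diam_pow_ge0.
apply: diam_pow_anti => //; apply: le_trans (dU i) _.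
by rewrite lee_fin ge_min lexx orbT.
Qed.

(** Each nonempty set costs 1 at exponent 0, so this is the fact that the
    counting measure vanishes only on the empty set. *)
Lemma null0_eq0 A : H 0 A = 0 <-> A = set0.
Proof.
split=> [/null_coverP h|->]; last first.
  apply/null_coverP => delta e d0 e0; exists (fun=> set0); split => //.
    by move=> i; apply: diam_le.
  by rewrite eseries0 ?lee_fin ?ltW// => i *; exact: diam_pow0.
apply/eqP; apply: contrapT => /negP/set0P[x Ax].
have half0 : (0 < 2^-1 :> R)%R by rewrite invr_gt0.
have [U [AU _ Ue]] := h 1%R 2^-1%R ltr01 half0.
have [i _ Ui] := AU _ Ax.
suff : 1 <= (2^-1)%:E :> \bar R by rewrite lee_fin; lra.
apply: le_trans Ue.
rewrite -(poweRe0 (diam (U i))) -diam_powE; last by exists x.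
apply: (@le_trans _ _ (\sum_(0 <= i < i.+1) diam_pow 0 (U i))); last first.
  by apply: nneseries_lim_ge => *; exact: diam_pow_ge0.
by rewrite big_nat_recr//= leeDr// sume_ge0// => *; exact: diam_pow_ge0.
Qed.

Lemma dim_ge0 A : 0 <= dim A.
Proof. by apply: le_ereal_inf_tmp => _ [t [t0 _] <-]; rewrite lee_fin. Qed.

Lemma dim_le_null t A : (0 <= t)%R -> H t A = 0 -> dim A <= t%:E.
Proof. by move=> t0 h; apply: ereal_inf_lbound; exists t. Qed.

Lemma null_dim_lt t A : dim A < t%:E -> H t A = 0.
Proof.
move=> /ereal_inf_lt[_ [r [r0 hr] <-]]; rewrite lte_fin => /ltW rt.
exact: null_anti hr.
Qed.

Lemma dim_ge_nnull t A : H t A <> 0 -> t%:E <= dim A.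
Proof. by move=> h; rewrite leNgt; apply/negP => /null_dim_lt. Qed.

Lemma dim_mono A B : A `<=` B -> dim A <= dim B.
Proof.
move=> AB; apply: le_ereal_inf_tmp => _ [t [t0 ht] <-].
by apply: dim_le_null => //; exact: null_subset ht.
Qed.

Lemma dim_set0 : dim set0 = 0.
Proof.
apply/eqP; rewrite eq_le dim_ge0 andbT; apply: dim_le_null => //.
exact/null0_eq0.
Qed.

End HausdorffNull.

(** Two distances are compared along a common parametrisation of the two sets
    instead of along a map between them.  In this form neither map has to be
    injective, and a bi-Lipschitz comparison is just the statement used twice
    with the roles exchanged. *)
Section Transfer.
Context {R : realType} {X T1 T2 : Type}.
Variables (dist1 : T1 -> T1 -> R) (dist2 : T2 -> T2 -> R).
Hypothesis dist1_ge0 : forall x y, (0 <= dist1 x y)%R.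
Hypothesis dist2_ge0 : forall x y, (0 <= dist2 x y)%R.
Variables (h1 : X -> T1) (h2 : X -> T2) (Z : set X) (L : R).
Hypothesis L0 : (0 < L)%R.
Hypothesis lip : forall x y, Z x -> Z y ->
  (dist2 (h2 x) (h2 y) <= L * dist1 (h1 x) (h1 y))%R.

Lemma null_transfer (t : R) : (0 <= t)%R ->
  hausdorff_measure dist1 t (h1 @` Z) = 0 ->
  hausdorff_measure dist2 t (h2 @` Z) = 0.
Proof.
move=> t0 /null_coverP h; apply/null_coverP.
move=> delta e d0 e0.
have Lt : (0 < L `^ t)%R by exact: powR_gt0.
have [U [AU dU Ue]] := h _ _ (divr_gt0 d0 L0) (divr_gt0 e0 Lt).
pose V i := h2 @` (Z `&` h1 @^-1` (U i)).
have dV i : diam dist2 (V i) <= L%:E * diam dist1 (U i).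
  apply: diam_le => _ _ [x [Zx Ux] <-] [y [Zy Uy] <-].
  apply: (@le_trans _ _ (L%:E * (dist1 (h1 x) (h1 y))%:E)).
    by rewrite -EFinM lee_fin lip.
  by apply: lee_wpmul2l; [rewrite lee_fin ltW|exact: dist_le_diam].
have pV i : diam_pow dist2 t (V i) <= (L `^ t)%:E * diam_pow dist1 t (U i).
  have [->|/set0P Vne] := eqVneq (V i) set0.
    by rewrite diam_pow0 mule_ge0 ?diam_pow_ge0// lee_fin ltW.
  have Une : U i !=set0 by case: Vne => _ [x [_ Ux] _]; exists (h1 x).
  have L0' : 0 <= L%:E by rewrite lee_fin ltW.
  have dU0 := diam_ge0 dist1_ge0 Une; have dV0 := diam_ge0 dist2_ge0 Vne.
  rewrite !diam_powE// -poweR_EFin -poweRM//.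
  by apply: (gt0_ler_poweR t0) (dV i); rewrite in_itv/= leey andbT ?mule_ge0.
exists V; split.
- move=> _ [x Zx <-]; have [|i _ Ui] := AU (h1 x); first by exists x.
  by exists i => //; exists x.
- move=> i; apply: le_trans (dV i) _.
  rewrite (_ : delta = L * (delta / L))%R; last by rewrite mulrC divfK// gt_eqF.
  by rewrite EFinM; apply: lee_wpmul2l; [rewrite lee_fin ltW|exact: dU].
apply: (@le_trans _ _ (\sum_(0 <= i <oo) (L `^ t)%:E * diam_pow dist1 t (U i))).
  by apply: lee_nneseries => *; [exact: diam_pow_ge0|exact: pV].
rewrite nneseriesZl; last by move=> *; exact: diam_pow_ge0.
rewrite (_ : e = L `^ t * (e / L `^ t))%R; last by rewrite mulrC divfK// gt_eqF.
by rewrite EFinM; apply: lee_wpmul2l => //; rewrite lee_fin ltW.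
Qed.

Lemma dim_transfer : hausdorff_dim dist2 (h2 @` Z) <= hausdorff_dim dist1 (h1 @` Z).
Proof.
apply: le_ereal_inf_tmp => _ [t [t0 ht] <-].
by apply: dim_le_null => //; exact: null_transfer.
Qed.

End Transfer.

(** * Extended sums, coordinates, and dyadic cells *)

Section EsumComplements.
Context {R : realType}.

(** Grouping the right-hand sum by the value of [f] leaves at least one term
    in each group.  With this, covers can be described by redundant families
    of cells: repetitions only increase the cost of the family. *)
Lemma esum_image_le (T1 T2 : choiceType) (f : T1 -> T2) (A : set T1)
    (a : T2 -> \bar R) : (forall y, 0 <= a y) ->
  \esum_(y in f @` A) a y <= \esum_(x in A) a (f x).
Proof.
move=> a0.
have -> : \esum_(x in A) a (f x)
    = \esum_(y in f @` A) \esum_(x in A `&` f @^-1` [set y]) a y.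
  rewrite esum_esum// (reindex_esum A _ (fun x => (f x, x)))//; split=> //.
  - by move=> x Ax /=; split; [exists x|split].
  - by move=> x y _ _ [].
  - by move=> [y x] [/= _ [Ax fx]]; exists x => //=; rewrite fx.
apply: le_esum => _ [x Ax <-]; rewrite -[leLHS](@esum_set1 R T1 x (fun=> a (f x)))//.
rewrite [leLHS]esum_mkcond [leRHS]esum_mkcond; apply: le_esum => z _.
case: ifPn => [|_]; last by case: ifPn.
by rewrite inE => ->; rewrite mem_set.
Qed.

Lemma esum_subset (T : choiceType) (A B : set T) (a : T -> \bar R) :
  (forall y, 0 <= a y) -> A `<=` B ->
  \esum_(y in A) a y <= \esum_(y in B) a y.
Proof.
move=> a0 AB; rewrite [leLHS]esum_mkcond [leRHS]esum_mkcond.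
apply: le_esum => z _; case: ifPn => [|_]; last by case: ifPn.
by rewrite inE => /AB Bz; rewrite mem_set.
Qed.

Lemma esum_term_le (T : choiceType) (A : set T) (a : T -> \bar R) x :
  (forall y, 0 <= a y) -> A x -> a x <= \esum_(y in A) a y.
Proof.
move=> a0 Ax; rewrite -[leLHS](@esum_set1 R T x a)//.
by apply: esum_subset => // _ ->.
Qed.

Lemma esumZl (T : choiceType) (A : set T) (a : T -> \bar R) (c : R) :
  (0 <= c)%R -> (forall y, 0 <= a y) ->
  \esum_(y in A) (c%:E * a y) = c%:E * \esum_(y in A) a y.
Proof.
move=> c0 a0; rewrite /esum.
have [->|cn] := eqVneq c 0%R.
  rewrite mul0e; apply/eqP; rewrite eq_le; apply/andP; split.
    apply: ge_ereal_sup => _ [X _ <-]; rewrite fsbig1// => i _.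
    by rewrite mul0e.
  by apply: ereal_sup_ubound; exists set0; rewrite ?fsbig_set0//; split.
have cp : (0 < c)%R by rewrite lt_neqAle eq_sym cn.
rewrite -ereal_sup_pZl//.
congr ereal_sup; apply/seteqP; split.
  move=> _ [X XA <-]; exists (\sum_(x \in X) a x); first by exists X.
  by rewrite ge0_mule_fsumr.
by move=> _ [_ [X XA <-] <-]; exists X => //; rewrite ge0_mule_fsumr.
Qed.

(** The enumeration of a countable type turns sums over cells into series,
    which is the form in which Hausdorff covers and the theorem on integrating
    a series term by term are stated. *)
Lemma esum_countable (T : countType) (A : set T) (a : T -> \bar R) :
  (forall y, 0 <= a y) ->
  \esum_(y in A) a y =
  \sum_(0 <= i <oo)
    (if pickle_inv i is Some y then if y \in A then a y else 0 else 0).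
Proof.
move=> a0; rewrite esum_mkcond nneseries_esumT; last first.
  by move=> i; case: pickle_inv => // y; case: ifP.
rewrite (esumID (range (@pickle T)) setT); last first.
  by move=> i _; case: pickle_inv => // y; case: ifP.
rewrite [X in _ + X]esum1 ?adde0; last first.
  move=> i [_ ni]; have := @pickle_invK T i.
  by case: (pickle_inv i) => // y yi; exfalso; apply: ni; exists y.
rewrite setTI esum_image; last by move=> x y _ _; exact: (pcan_inj pickleK).
by apply: eq_esum => y _; rewrite pickleK_inv.
Qed.

Lemma esum_const_le (T : finType) (c : R) : (0 <= c)%R ->
  \esum_(s in [set: T]) c%:E <= (#|T|%:R * c)%:E.
Proof.
move=> c0; have fT : finite_set [set: T] by exact: finite_finset.
rewrite esum_fset// fsbig_finite//= sumEFin big_const_seq count_predT.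
rewrite iter_addr_0 lee_fin -[leLHS]mulr_natl; apply: ler_wpM2r => //.
by rewrite ler_nat -(card_uniqP (finmap.fset_uniq _)) max_card.
Qed.

End EsumComplements.

Section EuclideanDistance.
Context {R : realType} {m : nat}.
Implicit Types (u v : 'rV[R]_m).
Local Open Scope ring_scope.

Lemma enorm_ge0 u : 0 <= enorm u. Proof. exact: sqrtr_ge0. Qed.

Lemma euclidean_dist_ge0 u v : 0 <= euclidean_dist u v.
Proof. exact: enorm_ge0. Qed.

Lemma coord_le_enorm u i : `|u ord0 i| <= enorm u.
Proof.
rewrite -sqrtr_sqr; apply: ler_wsqrtr.
by rewrite (bigD1 i)//= lerDl sumr_ge0// => *; exact: sqr_ge0.
Qed.

(** The crude factor [m] in place of its square root is enough, since
    constants do not affect null sets. *)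
Lemma enorm_le u r : 0 <= r -> (forall i, `|u ord0 i| <= r) ->
  enorm u <= m%:R * r.
Proof.
move=> r0 h; rewrite -(@ger0_norm _ (m%:R * r)) ?mulr_ge0//.
rewrite -sqrtr_sqr; apply: ler_wsqrtr.
apply: (@le_trans _ _ (\sum_(i < m) r ^+ 2)).
  by apply: ler_sum => i _; rewrite -real_normK ?num_real// lerXn2r ?nnegrE.
rewrite sumr_const card_ord -[leLHS]mulr_natl exprMn.
apply: ler_wpM2r; first exact: sqr_ge0.
by rewrite -natrX ler_nat; case: (m) => // n; rewrite leq_pmulr.
Qed.

Lemma coord_le_dist u v i : `|u ord0 i - v ord0 i| <= euclidean_dist u v.
Proof. by have := coord_le_enorm (u - v) i; rewrite !mxE. Qed.

Lemma euclidean_dist_le u v r : 0 <= r ->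
  (forall i, `|u ord0 i - v ord0 i| <= r) -> euclidean_dist u v <= m%:R * r.
Proof. by move=> r0 h; apply: enorm_le => // i; rewrite !mxE. Qed.

End EuclideanDistance.

Section Nets.
Context {R : realType}.

(** The dyadic cell of side 2^-n containing [x], named by the integer vector
    that is 2^n times its lower corner. *)
Definition cell m (n : nat) (x : 'rV[R]_m) : 'rV[int]_m :=
  map_mx (fun r => Num.floor (2 ^+ n * r)%R) x.

Definition weight (t : R) (n : nat) : R := ((2 ^- n) `^ t)%R.

Definition net_cost m (t : R) (C : set (nat * 'rV[int]_m)) : \bar R :=
  \esum_(Q in C) (weight t Q.1)%:E.

Definition net_cover m (C : set (nat * 'rV[int]_m)) (A : set 'rV[R]_m) :=
  forall x, A x -> exists n, C (n, cell n x).

Definition net_null m t (A : set 'rV[R]_m) := forall e : R, (0 < e)%R ->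
  exists C, net_cover C A /\ net_cost t C <= e%:E.

Lemma cell_near m n (x y : 'rV[R]_m) i : cell n x = cell n y ->
  (`|x ord0 i - y ord0 i| <= 2 ^- n)%R.
Proof.
move=> /matrixP/(_ ord0 i); rewrite !mxE => h.
have p0 : (0 < 2 ^+ n :> R)%R by rewrite exprn_gt0.
rewrite -[leRHS]mulr1 -ler_pdivrMl ?invr_gt0// invrK.
rewrite -[X in (X * _)%R]gtr0_norm// -normrM mulrBr.
have hx := floor_itv (2 ^+ n * x ord0 i)%R.
have hy := floor_itv (2 ^+ n * y ord0 i)%R.
move: hx hy; rewrite h intrD; move: (_%:~R)%R => f.
by move=> /andP[? ?] /andP[? ?]; rewrite ler_norml; apply/andP; split; lra.
Qed.

(** Flooring to the coarse grid factors through the fine grid: floor r is the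
    integer quotient of floor (2^p r) by 2^p. *)
Lemma cell_refine m k n (x y : 'rV[R]_m) : (k <= n)%N ->
  cell n x = cell n y -> cell k x = cell k y.
Proof.
move=> kn; rewrite -(subnK kn) => /matrixP h; apply/matrixP => i j.
have {h} := h i j; rewrite !mxE addnC exprD; move: (n - k)%N => p h.
have fl (r : R) : Num.floor r = (Num.floor (2 ^+ p * r)%R %/ (2 ^+ p))%Z.
  apply/esym/eqP.
  have p0 : (0 < 2 ^+ p :> int)%R by rewrite exprn_gt0.
  set f := Num.floor _; set g := (f %/ _)%Z.
  have P0 : (0 < 2 ^+ p :> R)%R by rewrite exprn_gt0.
  have E : ((2 ^+ p)%:~R = 2 ^+ p :> R)%R by rewrite rmorphXn.
  rewrite eq_sym; apply/eqP; apply: floor_def.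
  have /andP[f1 f2] := floor_itv (2 ^+ p * r)%R; rewrite -/f in f1 f2.
  have g1 : (g * 2 ^+ p <= f)%R by apply: lez_floor; rewrite gt_eqF.
  have g2 : (f + 1 <= (g + 1) * 2 ^+ p)%R.
    by rewrite lezD1; apply: ltz_ceil.
  apply/andP; split.
    rewrite -(ler_pM2l P0) mulrC; apply: le_trans f1.
    by rewrite -E -intrM ler_int.
  rewrite -(ltr_pM2l P0); apply: lt_le_trans f2 _.
  by rewrite -E -intrM ler_int mulrC.
rewrite (fl (2 ^+ k * x i j)%R) (fl (2 ^+ k * y i j)%R) !mulrA.
by rewrite -(mulrC (2 ^+ k)%R) h.
Qed.

Lemma weight_gt0 t n : (0 < weight t n)%R.
Proof. by rewrite powR_gt0// invr_gt0 exprn_gt0. Qed.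

Lemma weight_ge0 t n : (0 <= weight t n)%R. Proof. exact/ltW/weight_gt0. Qed.

Lemma weightD s t n : weight (s + t) n = (weight s n * weight t n)%R.
Proof. by rewrite /weight powRD// invr_eq0 expf_neq0 ?implybT. Qed.

Lemma weight_nat k n : weight k%:R n = ((2 ^- n) ^+ k)%R.
Proof. by rewrite /weight powR_mulrn// invr_ge0 exprn_ge0. Qed.

End Nets.

(** * Dyadic covers detect Hausdorff null sets *)

Section NetsAndHausdorff.
Context {R : realType}.

Lemma exp2N_small (e : R) : (0 < e)%R -> exists n, (2 ^- n <= e)%R.
Proof.
move=> e0; have ei : (0 <= e^-1)%R by rewrite invr_ge0 ltW.
exists (Num.bound e^-1); rewrite -[leRHS]invrK lef_pV2 ?posrE ?invr_gt0 ?exprn_gt0//.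
apply: (le_trans (ltW (archi_boundP ei))).
by rewrite -natrX ler_nat ltnW// ltn_expl.
Qed.

Lemma weight_small (t e : R) : (0 < t)%R -> (0 < e)%R ->
  exists n, (weight t n <= e)%R.
Proof.
move=> t0 e0; have [n hn] := exp2N_small (powR_gt0 t^-1 e0).
have eE : e = ((e `^ t^-1) `^ t)%R.
  by rewrite -powRrM mulVf ?gt_eqF// powRr1// ltW.
exists n; rewrite eE; apply: (ge0_ler_powR (ltW t0)) hn.
  by rewrite nnegrE invr_ge0 exprn_ge0.
by rewrite nnegrE powR_ge0.
Qed.

(** The level is the last one whose mesh is still at least [D]; the slack [e]
    pays for sets of diameter 0, which have no last level. *)
Lemma level_of_diam (t D e : R) : (0 < t)%R -> (0 <= D <= 1)%R -> (0 < e)%R ->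
  exists n, (D <= 2 ^- n)%R /\ (weight t n <= 2 `^ t * D `^ t + e)%R.
Proof.
move=> t0 /andP[D0 D1] e0; have [Dz|Dn] := eqVneq D 0%R.
  have [n hn] := weight_small t0 e0; exists n; rewrite Dz.
  split; first by rewrite invr_ge0 exprn_ge0.
  by rewrite powR0 ?gt_eqF// mulr0 add0r.
have Dp : (0 < D)%R by rewrite lt_neqAle eq_sym Dn.
have ex : exists n, (2 ^- n < D)%R.
  have [|n hn] := @exp2N_small (D / 2)%R; first by rewrite divr_gt0.
  by exists n; lra.
have [[|n] hn hmin] := ex_minnP ex; first by move: hn; rewrite expr0 invr1; lra.
exists n; split; first by rewrite leNgt; apply/negP => /hmin; rewrite ltnn.
rewrite -powRM//; apply: ler_wpDr; first exact: ltW.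
apply: ge0_ler_powR; rewrite ?ltW// ?nnegrE ?mulr_ge0 ?invr_ge0 ?exprn_ge0//.
move: hn; rewrite exprS invfM; move: (2 ^- n)%R => z; lra.
Qed.

Context {m : nat}.
Implicit Types (A : set 'rV[R]_m) (t : R).
Local Notation H := (hausdorff_measure (@euclidean_dist R m)).

(** The cost alone controls the mesh: since [t] is positive, a cover of small
    cost consists of small cells. *)
Lemma net_null_hausdorff t A : (0 < t)%R -> net_null t A -> H t A = 0.
Proof.
move=> t0 hA; apply/null_coverP => delta e d0 e0.
pose M : R := (m%:R `^ t + 1)%R.
have M0 : (0 < M)%R by rewrite ltr_wpDl ?powR_ge0.
(* The first bound makes the total cost at most [e], the second forces every
   cell to have diameter at most [delta]. *)
pose e' : R := (Num.min e (delta `^ t) / M)%R.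
have e'0 : (0 < e')%R by rewrite divr_gt0// lt_min e0 powR_gt0.
have [C [CA Ce]] := hA _ e'0.
have wt0 (Q : nat * 'rV[int]_m) : 0 <= (weight t Q.1)%:E by rewrite lee_fin weight_ge0.
pose U i := [set x : 'rV[R]_m | exists Q : nat * 'rV[int]_m,
  [/\ pickle_inv i = Some Q, C Q & cell Q.1 x = Q.2]].
have dU i (Q : nat * 'rV[int]_m) : pickle_inv i = Some Q ->
    diam (@euclidean_dist R m) (U i) <= (m%:R * 2 ^- Q.1)%:E.
  move=> iQ; apply: diam_le => x y [Q1 [iQ1 _ hx]] [Q2 [iQ2 _ hy]].
  move: iQ1 iQ2 hx hy; rewrite iQ => -[<-] [<-] hx hy.
  rewrite lee_fin; apply: euclidean_dist_le.
    by rewrite invr_ge0 exprn_ge0.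
  by move=> j; apply: cell_near; rewrite hx.
have mwt n : ((m%:R * 2 ^- n) `^ t <= M * weight t n)%R.
  rewrite powRM// ?invr_ge0 ?exprn_ge0//; apply: ler_wpM2r; first exact: weight_ge0.
  by rewrite lerDl.
have UC i x : U i x -> exists2 Q : nat * 'rV[int]_m, pickle_inv i = Some Q & C Q.
  by move=> [Q [? ? _]]; exists Q.
exists U; split.
- move=> x /CA[n Cn]; exists (pickle (n, cell n x)) => //.
  by exists (n, cell n x); split => //; rewrite pickleK_inv.
- move=> i; have [->|/set0P[x Ux]] := eqVneq (U i) set0; first exact: diam_le.
  have [Q iQ CQ] := UC _ _ Ux; apply: le_trans (dU _ _ iQ) _; rewrite lee_fin.
  have Qe : (weight t Q.1 <= e')%R.
    by rewrite -lee_fin; apply: le_trans Ce; exact: esum_term_le.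
  rewrite leNgt; apply/negP => /(gt0_ltr_powR t0).
  have q0 : (0 <= m%:R * 2 ^- Q.1 :> R)%R by rewrite mulr_ge0// invr_ge0 exprn_ge0.
  rewrite !nnegrE => /(_ (ltW d0) q0); apply/negP; rewrite -leNgt.
  apply: le_trans (mwt _) _; rewrite mulrC -ler_pdivlMr//.
  apply: le_trans Qe _; rewrite ler_pM2r ?invr_gt0//.
  by rewrite ge_min lexx orbT.
apply: (@le_trans _ _ (M%:E * net_cost t C)); last first.
  apply: (@le_trans _ _ (M%:E * e'%:E)).
    by apply: lee_wpmul2l => //; rewrite lee_fin ltW.
  by rewrite -EFinM lee_fin mulrC divfK ?gt_eqF// ge_min lexx.
rewrite -esumZl//; last exact: ltW.
rewrite esum_countable; last by move=> Q; rewrite mule_ge0// lee_fin ltW.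
apply: lee_nneseries => [i _ _|i _]; first exact: diam_pow_ge0.
have [->|/set0P Une] := eqVneq (U i) set0.
  rewrite diam_pow0; case: pickle_inv => // Q; case: ifP => // _.
  by rewrite mule_ge0// lee_fin ltW.
have [x Ux] := Une; have [Q iQ CQ] := UC _ _ Ux.
rewrite iQ mem_set// diam_powE// -EFinM.
apply: (@le_trans _ _ ((m%:R * 2 ^- Q.1)%:E `^ t)); last first.
  by rewrite lee_fin.
have U0 := diam_ge0 (@euclidean_dist_ge0 R m) Une.
apply: (gt0_ler_poweR (ltW t0)) (dU i Q iQ); rewrite in_itv/= leey andbT//.
Qed.

(** A set of diameter at most the mesh meets only the 3^m cells adjacent to
    the cell of one of its points; [s] lists the offsets as digits 0, 1, 2
    standing for -1, 0, 1. *)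
Lemma cell_shift n (x y : 'rV[R]_m) :
  (forall j, `|x ord0 j - y ord0 j| <= 2 ^- n)%R ->
  exists s : 'rV['I_3]_m,
    cell n x = (cell n y + map_mx (fun k : 'I_3 => k%:Z - 1) s)%R.
Proof.
move=> h; pose z := (cell n x - cell n y)%R.
exists (map_mx (fun i : int => inord (absz (i + 1)%R)) z).
apply/matrixP => i j; rewrite ord1 !mxE.
set a := Num.floor _; set b := Num.floor _.
have /andP[a1 a2] := floor_itv (2 ^+ n * x ord0 j)%R; rewrite -/a in a1 a2.
have /andP[b1 b2] := floor_itv (2 ^+ n * y ord0 j)%R; rewrite -/b in b1 b2.
have p0 : (0 < 2 ^+ n :> R)%R by rewrite exprn_gt0.
have := h j; rewrite -(ler_pM2l p0) divff ?gt_eqF//.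
rewrite -[X in (X * _)%R](gtr0_norm p0) -normrM mulrBr ler_norml => /andP[h1 h2].
have l1 : (b - a < 2)%R by rewrite -(ltr_int R) intrB; lra.
have l2 : (a - b < 2)%R by rewrite -(ltr_int R) intrB; lra.
have k0 : (0 <= a - b + 1)%R by lia.
by rewrite inordK ?gez0_abs//; lia.
Qed.

Lemma hausdorff_net_null t A : (0 < t)%R -> H t A = 0 -> net_null t A.
Proof.
move=> t0 /null_coverP hA e e0.
pose N : nat := #|{: 'rV['I_3]_m}|.
have K0 : (0 < 2 `^ t :> R)%R by exact: powR_gt0.
(* Each of the at most [N] cells adjacent to a set of the cover costs at most
   2^t times the cost of the set plus an error; [e1] is spent once on the sets
   and once on the errors. *)
pose e1 : R := (e / (2 * N.+1%:R))%R.
have e10 : (0 < e1)%R by rewrite divr_gt0.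
have [U [AU dU Ue]] := hA 1%R _ ltr01 (divr_gt0 e10 K0).
have lev i : exists n, U i !=set0 ->
    diam (@euclidean_dist R m) (U i) <= (2 ^- n)%:E /\
    (weight t n)%:E <= (2 `^ t)%:E * diam_pow (@euclidean_dist R m) t (U i)
                   + (e1 / (2 ^ i.+1)%:R)%:E.
  have [->|/set0P Une] := eqVneq (U i) set0; first by exists 0%N => -[].
  rewrite diam_powE//; move: (dU i) (diam_ge0 (@euclidean_dist_ge0 R m) Une).
  case: (diam _ _) => // D; rewrite !lee_fin => D1 D0.
  have [||n [n1 n2]] := @level_of_diam t D (e1 / (2 ^ i.+1)%:R) t0.
  - by rewrite D0.
  - by rewrite divr_gt0// ltr0n expn_gt0.
  by exists n => _; rewrite lee_fin.
have [n hn] := choice lev.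
pose x i := xget 0%R (U i).
pose f (p : nat * 'rV['I_3]_m) : nat * 'rV[int]_m :=
  (n p.1, cell (n p.1) (x p.1) + map_mx (fun k : 'I_3 => k%:Z - 1) p.2)%R.
pose I : set nat := [set i | U i !=set0].
exists (f @` (I `*`` (fun=> setT))); split.
  move=> y /AU[i _ Uy]; exists (n i).
  have Une : U i !=set0 by exists y.
  have [n1 _] := hn i Une.
  have [|s hs] := @cell_shift (n i) y (x i).
    move=> j; rewrite -lee_fin; apply: le_trans n1.
    apply: le_trans (dist_le_diam _ Uy (xgetPex 0%R Une)).
    by rewrite lee_fin coord_le_dist.
  by exists (i, s) => //; rewrite /f/= hs.
have wt0 (Q : nat * 'rV[int]_m) : 0 <= (weight t Q.1)%:E by rewrite lee_fin weight_ge0.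
apply: le_trans (esum_image_le _ _ wt0) _.
rewrite -(@esum_esum _ _ _ I (fun=> setT) (fun i _ => (weight t (n i))%:E)); last first.
  by move=> *; rewrite lee_fin weight_ge0.
pose b i := (2 `^ t)%:E * diam_pow (@euclidean_dist R m) t (U i).
have b0 i : 0 <= b i by rewrite mule_ge0 ?diam_pow_ge0// lee_fin ltW.
have N0 : (0 <= N%:R :> R)%R by [].
have be0 i : 0 <= b i + (e1 / (2 ^ i.+1)%:R)%:E.
  by rewrite adde_ge0// lee_fin ltW// divr_gt0// ltr0n expn_gt0.
apply: (@le_trans _ _ (N%:R%:E * \sum_(0 <= i <oo) (b i + (e1 / (2 ^ i.+1)%:R)%:E))).
  rewrite nneseries_esumT// -esumZl//.
  apply: (@le_trans _ _ (\esum_(i in I) (N%:R%:E * (b i + (e1 / (2 ^ i.+1)%:R)%:E)))).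
    apply: le_esum => i Ii; apply: le_trans (esum_const_le _ (weight_ge0 _ _)) _.
    rewrite EFinM.
    by apply: lee_wpmul2l; [rewrite lee_fin|exact: (hn i Ii).2].
  by apply: esum_subset => // i; rewrite mule_ge0.
apply: (@le_trans _ _ (N%:R%:E * (e1 + e1)%:E)); last first.
  have N1 : (N.+1%:R != 0 :> R)%R by rewrite pnatr_eq0.
  have -> : (e1 + e1 = e / N.+1%:R)%R by rewrite /e1; field.
  rewrite -EFinM lee_fin mulrCA; apply: ler_piMr; first exact: ltW.
  by rewrite ler_pdivrMr// mul1r ler_nat.
apply: lee_wpmul2l; first by rewrite lee_fin.
apply: le_trans (epsilon_trick _ b0 (ltW e10)) _.
rewrite EFinD; apply: leeD => //; rewrite nneseriesZl; last first.
  by move=> *; exact: diam_pow_ge0.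
rewrite (_ : e1 = 2 `^ t * (e1 / 2 `^ t))%R; last by rewrite mulrC divfK// gt_eqF.
by rewrite EFinM; apply: lee_wpmul2l => //; rewrite lee_fin ltW.
Qed.

Lemma net_nullE t A : (0 < t)%R -> H t A = 0 <-> net_null t A.
Proof.
by move=> t0; split; [exact: hausdorff_net_null|exact: net_null_hausdorff].
Qed.

Lemma net_null_bigcup t (A : nat -> set 'rV[R]_m) :
  (forall i, net_null t (A i)) -> net_null t (\bigcup_i A i).
Proof.
move=> hA e e0.
have he i : exists C, net_cover C (A i) /\ net_cost t C <= (e / (2 ^ i.+1)%:R)%:E.
  by apply: hA; rewrite divr_gt0// ltr0n expn_gt0.
have [C hC] := choice he.
pose J := [set: nat] `*`` C.
exists (snd @` J); split.
  move=> x [i _ /(hC i).1[n Cn]]; exists n.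
  by exists (i, (n, cell n x)).
have wt0 (Q : nat * 'rV[int]_m) : 0 <= (weight t Q.1)%:E by rewrite lee_fin weight_ge0.
apply: le_trans (esum_image_le _ _ wt0) _.
rewrite -(@esum_esum _ _ _ setT C (fun i Q => (weight t Q.1)%:E))//.
rewrite -nneseries_esumT; last by move=> i; exact: esum_ge0.
apply: (@le_trans _ _ (\sum_(0 <= i <oo) (0 + (e / (2 ^ i.+1)%:R)%:E))).
  apply: lee_nneseries => [i _ _|i _]; first exact: esum_ge0.
  by rewrite add0e; exact: (hC i).2.
apply: le_trans (epsilon_trick _ _ (ltW e0)) _ => //.
by rewrite eseries0// add0e.
Qed.

Lemma null_bigcup t (A : nat -> set 'rV[R]_m) : (0 < t)%R ->
  (forall i, H t (A i) = 0) -> H t (\bigcup_i A i) = 0.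
Proof.
move=> t0 h; apply/(net_nullE _ t0)/net_null_bigcup => i.
exact/(net_nullE _ t0).
Qed.

Lemma null_setU t A B : (0 < t)%R -> H t A = 0 -> H t B = 0 -> H t (A `|` B) = 0.
Proof.
move=> t0 hA hB; rewrite -bigcup2E; apply: null_bigcup => // -[|[|i]]//=.
by apply/(net_nullE _ t0) => e e0; exists set0; split=> //;
  rewrite /net_cost esum_set0 lee_fin ltW.
Qed.

Lemma dimH_setU_le A B (a : R) : (0 <= a)%R -> dimH A <= a%:E ->
  dimH B <= a%:E -> dimH (A `|` B) <= a%:E.
Proof.
move=> a0 hA hB; apply/lee_addgt0Pr => e e0.
rewrite -EFinD; have ae : (0 < a + e)%R by lra.
have lt : a%:E < (a + e)%:E by rewrite lte_fin; lra.
apply: dim_le_null; first exact: ltW.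
by apply: null_setU => //; apply: null_dim_lt;
  [exact: euclidean_dist_ge0|exact: le_lt_trans lt|
   exact: euclidean_dist_ge0|exact: le_lt_trans lt].
Qed.

End NetsAndHausdorff.

(** * Products: the lower bound, and cylinders *)

(** The product is presented by the projections [p1], [p2] and the maps [q1],
    [q2] they induce on cells, so that the result applies to any encoding of
    pairs whose cells project to cells; tuples of points are such an encoding. *)
Section ProductLowerBound.
Context {R : realType} {m m1 m2 : nat}.
Variables (p1 : 'rV[R]_m -> 'rV[R]_m1) (p2 : 'rV[R]_m -> 'rV[R]_m2).
Variables (q1 : 'rV[int]_m -> 'rV[int]_m1) (q2 : 'rV[int]_m -> 'rV[int]_m2).
Hypothesis pq1 : forall n x, cell n (p1 x) = q1 (cell n x).
Hypothesis pq2 : forall n x, cell n (p2 x) = q2 (cell n x).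
Variables (A : set 'rV[R]_m1) (B : set 'rV[R]_m2) (C : set 'rV[R]_m).
Hypothesis prodC : forall x y, A x -> B y -> exists z, [/\ C z, p1 z = x & p2 z = y].
Variables a b : R.

(** [C0] is a cover of the product.  [prefix x n] is the total [b]-weight of
    the cells of [C0] that lie over [x] and have level below [n]; it depends
    only on the cell of [x] of level [n], which makes it usable as a function
    of cells ([below], [at_cell]). *)
Section Threshold.
Variable C0 : set (nat * 'rV[int]_m).
Hypothesis C0C : net_cover C0 C.
Variables al be : R.
Hypothesis al0 : (0 <= al)%R.
Hypothesis be0 : (0 < be)%R.
Hypothesis costA : forall D, net_cover D A -> al%:E <= net_cost a D.
Hypothesis costB : forall D, net_cover D B -> be%:E < net_cost b D.

Let wtE (t : R) n : 0 <= (weight t n)%:E. Proof. by rewrite lee_fin weight_ge0. Qed.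

Let fibre (x : 'rV[R]_m1) : set (nat * 'rV[int]_m) :=
  [set P | C0 P /\ cell P.1 x = q1 P.2].

Let prefix x n := \esum_(P in [set P | fibre x P /\ (P.1 < n)%N]) (weight b P.1)%:E.

(** The second factors of the cells of [C0] lying over [x] cover [B]. *)
Let fibre_mass x : A x -> be%:E < \esum_(P in fibre x) (weight b P.1)%:E.
Proof.
move=> Ax; pose f (P : nat * 'rV[int]_m) := (P.1, q2 P.2).
have /costB/lt_le_trans : net_cover (f @` fibre x) B.
  move=> y By; have [z [Cz zx zy]] := prodC Ax By.
  have [n Cn] := C0C Cz; exists n; exists (n, cell n z).
    by split => //=; rewrite -pq1 zx.
  by rewrite /f/= -pq2 zy.
by apply; exact: (@esum_image_le R _ _ f (fibre x) (fun Q => (weight b Q.1)%:E)).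
Qed.

Let prefix_crosses x : A x -> exists n, be%:E < prefix x n.
Proof.
move=> /fibre_mass/ereal_sup_gt[_ [X [finX Xx] <-] hX].
pose n := (\max_(P <- finmap.enum_fset (fset_set X)) P.1)%N.
exists n.+1; apply: lt_le_trans hX _; apply: ereal_sup_ubound; exists X => //.
split=> // P XP; split; first exact: Xx.
rewrite ltnS.
apply: (@leq_bigmax_seq _ (finmap.enum_fset (fset_set X)) xpredT fst) => //.
by rewrite in_fset_set// inE.
Qed.

Let below (Q : nat * 'rV[int]_m1) :=
  \esum_(P in [set P | C0 P /\ (P.1 < Q.1)%N /\
    forall x : 'rV[R]_m1, cell Q.1 x = Q.2 -> cell P.1 x = q1 P.2]) (weight b P.1)%:E.

Let at_cell (Q : nat * 'rV[int]_m1) :=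
  \esum_(P in [set P | C0 P /\ (P.1, q1 P.2) = Q]) (weight b P.1)%:E.

Let belowE x n : below (n, cell n x) = prefix x n.
Proof.
rewrite /below /prefix; congr (esum _ _); apply/seteqP; split => P /=.
  by move=> [CP [Pn hx]]; split => //; split => //; exact: hx.
move=> [[CP Px] Pn]; split => //; split => // y hy.
by rewrite -Px; apply: cell_refine hy; exact: ltnW.
Qed.

Let prefixS x n : prefix x n.+1 = prefix x n + at_cell (n, cell n x).
Proof.
rewrite /prefix (esumID [set P | (P.1 < n)%N]); last by move=> *; exact: wtE.
congr (_ + _); congr (esum _ _); apply/seteqP; split => P /=.
- by move=> [[? _] ?].
- by move=> [? ?]; split => //; split => //; exact: ltnW.
- move=> [[[CP Px] Pn] /negP nP]; split => //.
  have Pe : P.1 = n by apply/eqP; rewrite eqn_leq -ltnS Pn leqNgt.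
  by rewrite -Px Pe.
- move=> [CP [<- e]]; split; last by rewrite ltnn.
  by split; [split|exact: leqnn].
Qed.

(** The thresholds for which [Q] is the stopping cell: those between the
    weight strictly above [Q] and that weight plus the weight attached to [Q].
    If the latter is infinite every larger threshold stops at [Q]. *)
Let window (Q : nat * 'rV[int]_m1) : set R :=
  if below Q is r%:E then
    if at_cell Q is s%:E then `]r, (r + s)%R]%classic else `]r, +oo[%classic
  else set0.

Let windowP Q u : below Q < u%:E -> u%:E <= below Q + at_cell Q -> window Q u.
Proof.
rewrite /window; have : 0 <= below Q by exact: esum_ge0.
have : 0 <= at_cell Q by exact: esum_ge0.
case: (below Q) => [r| |]; case: (at_cell Q) => [s| |] //= _ _.
  by rewrite in_itv/= lte_fin -EFinD lee_fin => -> ->.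
by rewrite in_itv/= lte_fin => ->.
Qed.

(** Along the cells of [x] the weight starts at 0 and eventually exceeds [be],
    so it crosses [u] at a first level. *)
Let window_cover u : (0 < u <= be)%R ->
  net_cover [set Q | window Q u] A.
Proof.
move=> /andP[u0 ub] x Ax.
have ex : exists n, `[< u%:E <= prefix x n >].
  have [n hn] := prefix_crosses Ax; exists n; apply/asboolP/ltW.
  by apply: le_lt_trans hn; rewrite lee_fin.
have [[|n] /asboolP hn hmin] := ex_minnP ex.
  move: hn; rewrite /prefix (_ : [set P | _ ] = set0).
    by rewrite esum_set0 lee_fin leNgt u0.
  by apply/seteqP; split => P //= [].
exists n; apply: windowP; rewrite belowE -?prefixS//.
rewrite ltNge; apply/negP => h.
by have := hmin n; rewrite ltnn => /(_ (introT (asboolP _) h)).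
Qed.

Let measurable_window Q : measurable (window Q).
Proof.
by rewrite /window; case: (below Q) => // r; case: (at_cell Q).
Qed.

Let mu := @lebesgue_measure R.

(** This is the averaging step: a cell is selected for a set of thresholds
    whose length is at most its own weight. *)
Let mu_window Q : mu (window Q) <= at_cell Q.
Proof.
have s0 : 0 <= at_cell Q by exact: esum_ge0.
rewrite /window; case: (below Q) => [r| |]; rewrite /mu ?measure0//.
move: s0; case: (at_cell Q) => [s| |] // s0; last by rewrite leey.
rewrite /mu lebesgue_measure_itv/= lte_fin; case: ifPn => // _.
by rewrite -EFinD lee_fin addrAC subrr add0r.
Qed.

Let term (i : nat) (u : R) : \bar R :=
  if pickle_inv i is Some Q then
    (weight a (Q : nat * 'rV[int]_m1).1 * \1_(window Q) u)%:E else 0.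

Let term_ge0 i u : 0 <= term i u.
Proof. by rewrite /term; case: pickle_inv => // Q; rewrite lee_fin mulr_ge0 ?weight_ge0. Qed.

Let measurable_term i : measurable_fun (`]0%R, be]%classic : set R) (term i).
Proof.
rewrite /term; case: pickle_inv => [Q|]; last exact: measurable_cst.
apply/measurable_EFinP/measurable_funM; first exact: measurable_cst.
by apply: measurable_indic.
Qed.

Let integral_term i : \int[mu]_(u in `]0%R, be]) term i u <=
  if pickle_inv i is Some Q then
    (weight a (Q : nat * 'rV[int]_m1).1)%:E * at_cell Q else 0.
Proof.
rewrite /term; case: pickle_inv => [Q|]; last by rewrite integral0.
under eq_integral do rewrite EFinM.
have mI : measurable_fun (`]0%R, be]%classic : set R)
    (EFin \o (\1_(window Q) : R -> R)).
  by apply/measurable_EFinP/measurable_indic.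
rewrite ge0_integralZl//=.
rewrite integral_indic//; last exact: measurable_window.
apply: lee_wpmul2l; first exact: wtE.
apply: le_trans (mu_window Q); apply: le_measure; rewrite ?inE//.
  by apply: measurableI => //; exact: measurable_window.
exact: measurable_window.
Qed.

(** For each threshold [u] between 0 and [be] the cells it selects cover [A]
    and so cost at least [al]; integrate this over [u].  After exchanging sum
    and integral, the pairs (cell, element of [C0] over it) are counted once
    each. *)
Lemma threshold_bound : al%:E * be%:E <= net_cost (a + b) C0.
Proof.
have -> : al%:E * be%:E = \int[mu]_(u in `]0%R, be]) al%:E.
  rewrite integral_cst//= /mu lebesgue_measure_itv/= lte_fin be0.
  by rewrite -EFinB subr0.
apply: (@le_trans _ _ (\int[mu]_(u in `]0%R, be]) \sum_(0 <= i <oo) term i u)).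
  apply: ge0_le_integral => //.
    apply: (ge0_emeasurable_sum (P := xpredT) (h := term)) => [i u _ _|i _].
      exact: term_ge0.
    exact: measurable_term.
  move=> u; rewrite /= in_itv/= => ub.
  apply: le_trans (costA (window_cover ub)) _.
  rewrite /net_cost esum_countable//; apply: lee_nneseries => [i _ _|i _].
    by case: pickle_inv => // Q; case: ifP.
  rewrite /term; case: pickle_inv => // Q; rewrite indicE.
  by rewrite (_ : (Q \in _) = (u \in window Q)) ?mulr1 ?mulr0;
    [case: ifP => _; rewrite ?mulr1 ?mulr0|apply/idP/idP; rewrite !inE].
rewrite integral_nneseries//.
apply: (@le_trans _ _ (\esum_(Q in setT) ((weight a Q.1)%:E * at_cell Q))).
  rewrite esum_countable; last by move=> Q; rewrite mule_ge0// esum_ge0.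
  apply: lee_nneseries => [i _ _|i _]; first exact: integral_ge0.
  apply: le_trans (integral_term i) _.
  by case: pickle_inv => // Q; rewrite in_setT.
under eq_esum => Q _ do rewrite -esumZl ?weight_ge0//.
rewrite esum_esum; last by move=> *; rewrite mule_ge0.
rewrite (reindex_esum C0 _ (fun P => ((P.1, q1 P.2), P))); last first.
  split=> //.
  - by move=> x y _ _ [_ _].
  - by move=> [Q P] [/= _ [CP QP]]; exists P => //; rewrite QP.
by apply: le_esum => P CP; rewrite /= weightD EFinM.
Qed.

End Threshold.

Theorem net_null_product :
  net_null (a + b) C -> net_null a A \/ net_null b B.
Proof.
move=> hC; apply: contrapT => /not_orP[nA nB].
have witness k (t : R) (S : set 'rV[R]_k) : ~ net_null t S ->
    exists2 e : R, (0 < e)%R & forall D, net_cover D S -> e%:E < net_cost t D.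
  move=> /existsNP[e /not_implyP[e0 /forallNP he]]; exists e => // D DS.
  by rewrite ltNge; apply/negP => De; exact: (he D).
have [al al0 hal] := witness _ _ _ nA; have [be be0 hbe] := witness _ _ _ nB.
have [|C0 [C0C C0le]] := hC (al * be / 2)%R; first by rewrite divr_gt0// mulr_gt0.
have h1 D : net_cover D A -> al%:E <= net_cost a D by move=> /hal/ltW.
have := le_trans (threshold_bound C0C (ltW al0) be0 h1 hbe) C0le.
have : (0 < al * be)%R by rewrite mulr_gt0.
by rewrite -EFinM lee_fin; move: (al * be)%R => z; lra.
Qed.

End ProductLowerBound.

(** A cell of level [l] times a unit cube of dimension [n] is the union of
    2^(l n) cells of level [l], so the cost of the cover at exponent [t + n]
    is the cost of the original one at exponent [t]. *)
Section CylinderUpperBound.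
Context {R : realType} {m n : nat}.
Implicit Types (A : set 'rV[R]_m) (t : R).

Lemma net_null_cylinder t A (c : 'rV[int]_n) : net_null t A ->
  net_null (t + n%:R)
    [set x : 'rV[R]_(m + n) | A (lsubmx x) /\ cell 0 (rsubmx x) = c].
Proof.
move=> hA e e0; have [C [CA Ce]] := hA e e0.
(* The cells of level [l] in the unit cube with corner [c] have corners 2^l c
   + s with all digits of [s] below 2^l. *)
pose sub (l : nat) (s : 'rV['I_(2 ^ l)]_n) : 'rV[int]_n :=
  \matrix_(i, j) ((2 ^ l)%N%:Z * c i j + (s i j)%:Z)%R.
pose S l := @sub l @` setT.
pose f (p : (nat * 'rV[int]_m) * 'rV[int]_n) := (p.1.1, row_mx p.1.2 p.2).
have wt0 (t' : R) k : 0 <= (weight t' k)%:E by rewrite lee_fin weight_ge0.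
exists (f @` (C `*`` (fun P => S P.1))); split.
  move=> x [Ax hc]; have [l Cl] := CA _ Ax; exists l.
  exists ((l, cell l (lsubmx x)), cell l (rsubmx x)); last first.
    by rewrite /f/= /cell -map_row_mx hsubmxK.
  split => //=; pose z := (cell l (rsubmx x) - \matrix_(i, j) ((2 ^ l)%N%:Z * c i j))%R.
  have zP j : exists2 k, (k < 2 ^ l)%N & z ord0 j = k%:Z.
    rewrite /z -hc !mxE expr0 mul1r.
    set r := x ord0 (rshift m j); set a := Num.floor r; set b := Num.floor _.
    have /andP[a1 a2] := floor_itv r; rewrite -/a in a1 a2.
    have /andP[b1 b2] := floor_itv (2 ^+ l * r)%R; rewrite -/b in b1 b2.
    have P0 : (0 < 2 ^+ l :> R)%R by rewrite exprn_gt0.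
    have E : ((2 ^ l)%N%:Z%:~R = 2 ^+ l :> R)%R by rewrite -natrX.
    have h1 : ((2 ^ l)%N%:Z * a < b + 1)%R.
      rewrite -(ltr_int R) intrM E; apply: le_lt_trans _ b2.
      by rewrite ler_pM2l.
    have h2 : (b < (2 ^ l)%N%:Z * (a + 1))%R.
      rewrite -(ltr_int R) intrM E; apply: le_lt_trans b1 _.
      by rewrite ltr_pM2l.
    exists (absz (b - (2 ^ l)%N%:Z * a)%R); last by rewrite gez0_abs//; lia.
    by rewrite -ltz_nat gez0_abs; lia.
  have zE j : (cell l (rsubmx x) ord0 j = (2 ^ l)%N%:Z * c ord0 j + z ord0 j)%R.
    by rewrite /z !mxE [RHS]addrC subrK.
  have p2 : (0 < 2 ^ l)%N by rewrite expn_gt0.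
  exists (map_mx (fun i : int => insubd (Ordinal p2) (absz i)) z) => //.
  apply/matrixP => i j; rewrite ord1 mxE [X in (_ + (nat_of_ord X)%:Z)%R]mxE.
  have [k kl zk] := zP j; rewrite zk /= val_insubd kl.
  by rewrite -zk zE.
apply: le_trans (@esum_image_le R _ _ f _ (fun Q => (weight (t + n%:R) Q.1)%:E) _) _.
  by move=> Q; exact: wt0.
rewrite -(@esum_esum _ _ _ C (fun P => S P.1) (fun P _ => (weight (t + n%:R) P.1)%:E))//.
apply: le_trans Ce; apply: le_esum => -[l z] _ /=.
apply: le_trans (esum_image_le _ _ (fun=> wt0 _ _)) _.
apply: le_trans (esum_const_le _ (weight_ge0 _ _)) _.
rewrite lee_fin card_mx card_ord mul1n weightD weight_nat exprVn !natrX mulrCA.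
by rewrite divff ?mulr1// !expf_neq0.
Qed.

Lemma null_cylinder t A : (0 < t)%R ->
  hausdorff_measure (@euclidean_dist R m) t A = 0 ->
  hausdorff_measure (@euclidean_dist R (m + n)) (t + n%:R)
    [set x | A (lsubmx x)] = 0.
Proof.
move=> t0 /(net_nullE _ t0) hA; apply/net_nullE; first by rewrite ltr_wpDr.
pose F i := if pickle_inv i is Some c then
  [set x : 'rV[R]_(m + n) | A (lsubmx x) /\ cell 0 (rsubmx x) = c] else set0.
rewrite (_ : [set x | _] = \bigcup_i F i).
  apply: net_null_bigcup => i; rewrite /F; case: pickle_inv => [c|].
    exact: net_null_cylinder.
  by move=> e e0; exists set0; split=> //; rewrite /net_cost esum_set0 lee_fin ltW.
apply/seteqP; split => x /=.
  move=> Ax; exists (pickle (cell 0 (rsubmx x))) => //.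
  by rewrite /F pickleK_inv.
by move=> [i _]; rewrite /F; case: pickle_inv => // c [].
Qed.

End CylinderUpperBound.

Section AmbientDimension.
Context {R : realType}.

(** The whole space is the cylinder over the one point of the space of
    dimension 0. *)
Lemma null_of_ambient_dim_lt n (t : R) (A : set 'rV[R]_n) : (n%:R < t)%R ->
  hausdorff_measure (@euclidean_dist R n) t A = 0.
Proof.
move=> nt; apply: (@null_subset _ _ _ _ _ [set x : 'rV[R]_(0 + n) | setT (lsubmx x)]) => //.
have t0 : (0 < t - n%:R)%R by rewrite subr_gt0.
rewrite -(subrK n%:R t); apply: null_cylinder => //.
apply/net_nullE => // e e0; have [l le] := weight_small t0 e0.
exists [set (l, const_mx 0%R)]; split.
  by move=> x _; exists l; rewrite /= [cell l x]thinmx0 [const_mx _]thinmx0.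
by rewrite /net_cost esum_set1 ?lee_fin ?weight_ge0.
Qed.

Lemma dimH_le n (A : set 'rV[R]_n) : dimH A <= n%:R%:E.
Proof.
apply/lee_addgt0Pr => e e0; rewrite -EFinD.
apply: dim_le_null; first by rewrite addr_ge0// ltW.
by apply: null_of_ambient_dim_lt; rewrite ltrDl.
Qed.

Lemma dimH_fin_num n (A : set 'rV[R]_n) : dimH A \is a fin_num.
Proof.
rewrite ge0_fin_numE; first exact: le_lt_trans (dimH_le A) (ltry _).
exact: dim_ge0.
Qed.

Lemma dimH_real n (A : set 'rV[R]_n) :
  exists2 r : R, (0 <= r)%R & dimH A = r%:E.
Proof.
exists (fine (dimH A)); first exact/fine_ge0/dim_ge0.
by rewrite fineK// dimH_fin_num.
Qed.

End AmbientDimension.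

(** * Tuples of points and the affinely dependent ones *)

Section EuclideanTransfer.
Context {R : realType}.

Lemma null_image m1 m2 (h : 'rV[R]_m1 -> 'rV[R]_m2) (Z : set 'rV[R]_m1) (L t : R) :
  (0 <= t)%R -> (0 < L)%R ->
  (forall x y j, Z x -> Z y ->
     `|h x ord0 j - h y ord0 j| <= L * euclidean_dist x y)%R ->
  hausdorff_measure (@euclidean_dist R m1) t Z = 0 ->
  hausdorff_measure (@euclidean_dist R m2) t (h @` Z) = 0.
Proof.
move=> t0 L0 hL Z0.
have M0 : (0 < m2.+1%:R * L)%R by rewrite mulr_gt0.
apply: (@null_transfer _ _ _ _ (@euclidean_dist R m1) (@euclidean_dist R m2)
   _ _ id h Z _ M0) => //; rewrite ?image_id//; try exact: euclidean_dist_ge0.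
move=> x y Zx Zy; rewrite -mulrA.
have D0 : (0 <= L * euclidean_dist x y)%R.
  by rewrite mulr_ge0 ?euclidean_dist_ge0// ltW.
apply: le_trans (euclidean_dist_le D0 _) _; first by move=> j; exact: hL.
by rewrite ler_wpM2r// ler_nat.
Qed.

End EuclideanTransfer.

Section PowerSets.
Context {R : realType} {d : nat}.
Implicit Types (F : set 'rV[R]_d).
Local Notation H := (hausdorff_measure (@euclidean_dist R _)).

Definition insert_row k (j : 'I_k.+1) (v : 'rV[R]_d) (Y : 'M[R]_(k, d)) :
    'M[R]_(k.+1, d) :=
  \matrix_(i, l) if unlift j i is Some i' then Y i' l else v ord0 l.

Lemma row_insert_row k j v Y : row j (@insert_row k j v Y) = v.
Proof. by apply/rowP => l; rewrite !mxE unlift_none. Qed.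

Lemma row'_insert_row k j v Y : row' j (@insert_row k j v Y) = Y.
Proof. by apply/matrixP => i l; rewrite !mxE liftK. Qed.

Lemma insert_rowK k j (X : 'M[R]_(k.+1, d)) : insert_row j (row j X) (row' j X) = X.
Proof.
apply/matrixP => i l; rewrite mxE; case: unliftP => [i'|] ->; by rewrite !mxE.
Qed.

Lemma power_set_insert_row F k j v Y : F v -> power_set k F (mxvec Y) ->
  power_set k.+1 F (mxvec (@insert_row k.+1 j v Y)).
Proof.
move=> Fv; rewrite /power_set /= mxvecK => FY i; rewrite mxvecK.
case: (unliftP j i) => [i'|] ->; last by rewrite row_insert_row.
suff -> : row (lift j i') (insert_row j v Y) = row i' Y by [].
by apply/rowP => l; rewrite !mxE liftK.
Qed.

Lemma power_set_row' F k j x : power_set k.+1 F x ->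
  power_set k F (mxvec (row' j (vec_mx x))).
Proof.
move=> Fx i; rewrite mxvecK.
by rewrite (_ : row i _ = row (lift j i) (vec_mx x))//; apply/rowP => l; rewrite !mxE.
Qed.

Lemma null_power_setS F k (a b : R) : (0 < a)%R -> (0 < b)%R ->
  H (a + b)%R (power_set k.+1 F) = 0 -> H a F = 0 \/ H b (power_set k F) = 0.
Proof.
move=> a0 b0 /net_nullE; rewrite addr_gt0// => /(_ isT) h.
pose p1 (x : 'rV[R]_(k.+2 * d)) := row ord0 (vec_mx x).
pose p2 (x : 'rV[R]_(k.+2 * d)) : 'rV[R]_(k.+1 * d) := mxvec (row' ord0 (vec_mx x)).
pose q1 (x : 'rV[int]_(k.+2 * d)) := row ord0 (vec_mx x).
pose q2 (x : 'rV[int]_(k.+2 * d)) : 'rV[int]_(k.+1 * d) := mxvec (row' ord0 (vec_mx x)).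
have pq1 n x : cell n (p1 x) = q1 (cell n x) by rewrite /q1 /cell -map_vec_mx -map_row.
have pq2 n x : cell n (p2 x) = q2 (cell n x).
  by rewrite /q2 /cell -map_vec_mx -map_row' -map_mxvec.
have prodC x y : F x -> power_set k F y ->
    exists z, [/\ power_set k.+1 F z, p1 z = x & p2 z = y].
  move=> Fx Fy; exists (mxvec (insert_row ord0 x (vec_mx y))); split.
  - by apply: power_set_insert_row => //; rewrite vec_mxK.
  - by rewrite /p1 mxvecK row_insert_row.
  - by rewrite /p2 mxvecK row'_insert_row vec_mxK.
by case: (net_null_product pq1 pq2 prodC h) => h'; [left|right]; apply/net_nullE.
Qed.

Lemma nnull_power_set F k (s : R) : (0 < s)%R -> H s F <> 0 ->
  H (k.+1%:R * s)%R (power_set k F) <> 0.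
Proof.
move=> s0 hF; elim: k => [|k IH]; last first.
  rewrite -natr1 mulrDl mul1r addrC => /null_power_setS[]//.
  by rewrite mulr_gt0.
rewrite mul1r => h; apply: hF.
pose f (x : 'rV[R]_(1 * d)) := row ord0 (vec_mx x).
have -> : F = f @` power_set 0 F.
  apply/seteqP; split => [x Fx|_ [x Fx <-]]; last exact: Fx.
  exists (mxvec x); last by rewrite /f mxvecK; apply/rowP => i; rewrite mxE.
  move=> i; rewrite mxvecK (_ : row i x = x)//.
  by apply/rowP => l; rewrite mxE ord1.
apply: (null_image (ltW s0) ltr01 _ h) => x y j _ _; rewrite mul1r !mxE.
exact: coord_le_dist.
Qed.

Section Dependent.
Variable k : nat.

(** A dependent tuple is recovered from the position [j] of a point that
    depends on the others, the other points, and the coefficients of the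
    dependence.  The coefficients are left unconstrained (their sum is 1 in
    the affine case): the resulting bound dim F^k + k is already small enough. *)
Definition dependent_param (j : 'I_k.+1) (w : 'rV[R]_(k * d + k)) :
    'rV[R]_(k.+1 * d) :=
  let Y := vec_mx (lsubmx w) in mxvec (insert_row j (rsubmx w *m Y) Y).

Lemma dependentE (x : 'rV[R]_(k.+1 * d)) : affinely_dependent x ->
  exists j (a : 'rV[R]_k),
    x = dependent_param j (row_mx (mxvec (row' j (vec_mx x))) a).
Proof.
move=> [c [/rV0Pn[j cj] _ c0]]; exists j.
exists (- (c ord0 j)^-1 *: col' j c)%R.
rewrite /dependent_param row_mxKl row_mxKr mxvecK.
suff -> : (- (c ord0 j)^-1 *: col' j c *m row' j (vec_mx x))%R = row j (vec_mx x).
  by rewrite insert_rowK vec_mxK.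
have h : (c ord0 j *: row j (vec_mx x) + col' j c *m row' j (vec_mx x))%R = 0%R.
  rewrite -c0; apply/rowP => l; rewrite !mxE (bigD1_ord j)//=.
  congr (_ + _)%R; first by rewrite mxE.
  by apply: eq_bigr => i _; rewrite !mxE.
rewrite -scalemxAl; move/eqP: h; rewrite addrC addr_eq0 => /eqP ->.
by rewrite scaleNr scalerN opprK scalerA mulVf// scale1r.
Qed.

(** The parametrisation is quadratic, hence Lipschitz on bounded sets only;
    the domain is exhausted by cubes. *)
Lemma null_dependent_param (A : set 'rV[R]_(k * d)) (t : R) (j : 'I_k.+1) :
  (0 < t)%R -> H t A = 0 ->
  H (t + k%:R)%R (dependent_param j @` [set w | A (lsubmx w)]) = 0.
Proof.
move=> t0 A0; have tk : (0 < t + k%:R)%R by rewrite ltr_wpDr.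
pose Z N := [set w : 'rV[R]_(k * d + k) | A (lsubmx w) /\
  forall i, (`|w ord0 i| <= N%:R)%R].
have -> : dependent_param j @` [set w | A (lsubmx w)]
    = \bigcup_N (dependent_param j @` (Z N)).
  apply/seteqP; split => [_ [w Aw <-]|_ [N _ [w [Aw _] <-]]]; last by exists w.
  exists (\sum_i Num.bound `|w ord0 i|)%N => //; exists w => //; split => // i.
  apply: le_trans (ltW (archi_boundP (normr_ge0 _))) _.
  by rewrite ler_nat (bigD1 i)//= leq_addr.
apply: null_bigcup => // N.
(* On coordinates bounded by [N], each of the [k] products in the inserted row
   contributes 2 N by a b - a' b' = a (b - b') + (a - a') b'. *)
pose L : R := (1 + k%:R * (2 * N%:R))%R.
apply: (@null_image _ _ _ _ _ L) => //; [exact: ltW| |move=> x y i|].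
- by rewrite ltr_wpDr// !mulr_ge0.
- move=> [_ xN] [_ yN].
  have D0 := euclidean_dist_ge0 x y.
  have DL : (euclidean_dist x y <= L * euclidean_dist x y)%R.
    by rewrite ler_peMl// lerDl !mulr_ge0.
  case/mxvec_indexP: i => i l; rewrite !mxvecE !mxE.
  case: unlift => [i'|].
    by rewrite ?mxE; apply: le_trans DL; exact: coord_le_dist.
  rewrite ?mxE -sumrB; apply: le_trans (ler_norm_sum _ _ _) _.
  apply: (@le_trans _ _ (\sum_(q < k) (2 * N%:R) * euclidean_dist x y)%R).
    apply: ler_sum => q _; rewrite ?mxE.
    set a := x _ _; set b := x _ _; set a' := y _ _; set b' := y _ _.
    rewrite (_ : a * b - a' * b' = a * (b - b') + (a - a') * b')%R; last by ring.
    apply: le_trans (ler_normD _ _) _; rewrite !normrM.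
    rewrite (_ : 2 * N%:R * _ = N%:R * euclidean_dist x y
       + euclidean_dist x y * N%:R)%R; last by ring.
    by rewrite lerD// ler_pM// ?xN ?yN// coord_le_dist.
  rewrite sumr_const card_ord -[leLHS]mulr_natl mulrA.
  by rewrite ler_wpM2r// lerDr.
- apply: (@null_subset _ _ _ _ _ [set w : 'rV[R]_(k * d + k) | A (lsubmx w)]).
    by move=> w [].
  exact: null_cylinder.
Qed.

End Dependent.

Lemma null_dependent F k (t : R) : (0 < t)%R -> H t (power_set k F) = 0 ->
  H (t + k.+1%:R)%R [set x | power_set k.+1 F x /\ affinely_dependent x] = 0.
Proof.
move=> t0 hF; have tk : (0 < t + k.+1%:R)%R by rewrite ltr_wpDr.
apply: (@null_subset _ _ _ _ _ (\bigcup_(i : nat) (dependent_param (inord i : 'I_k.+2)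
     @` [set w : 'rV[R]_(k.+1 * d + k.+1) | power_set k F (lsubmx w)]))).
  move=> x [Fx /dependentE[j [a xE]]]; exists (val j) => //=; rewrite inord_val.
  exists (row_mx (mxvec (row' j (vec_mx x))) a) => //=.
  by rewrite row_mxKl; exact: power_set_row'.
by apply: null_bigcup => // i; exact: null_dependent_param.
Qed.

Lemma dimH_power_set_ge F k (s : R) : (0 < s)%R -> s%:E < dimH F ->
  (k.+1%:R * s)%:E <= dimH (power_set k F).
Proof.
move=> s0 sF; apply: dim_ge_nnull; first exact: euclidean_dist_ge0.
apply: nnull_power_set => // h.
by have := dim_le_null (ltW s0) h; rewrite leNgt sF.
Qed.

(** With [p] the dimension of the k-tuples, the dependent (k+1)-tuples have
    dimension at most about [p + k] and all (k+1)-tuples at least about [p +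
    s]; the margin [eta], a third of [s - k], separates the two. *)
Lemma dimH_independent_tuples F k (s : R) : (1 <= k)%N -> (k%:R < s)%R ->
  s%:E < dimH F ->
  dimH (power_set k F) <= dimH (@independent_tuples R d k F).
Proof.
case: k => // k _ ks sF.
have s0 : (0 < s)%R by exact: le_lt_trans ks.
have sF0 : H s F <> 0.
  by move=> h; have := dim_le_null (ltW s0) h; rewrite leNgt sF.
have [p p0 pE] := dimH_real (power_set k F).
have [q q0 qE] := dimH_real (@independent_tuples R d k.+1 F).
have sp : (s <= p)%R.
  have := dimH_power_set_ge k s0 sF; rewrite pE lee_fin; apply: le_trans.
  by apply: ler_peMl; [exact: ltW|rewrite ler1n].
pose eta : R := ((s - k.+1%:R) / 3)%R.
have k0 : (0 <= k.+1%:R :> R)%R by [].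
have etaE : (s = k.+1%:R + 3 * eta)%R by rewrite /eta; field.
have e0 : (0 < eta)%R by rewrite divr_gt0// subr_gt0.
have pe : (0 < p - eta)%R by lra.
have pe' : (0 < p + eta)%R by lra.
have low : (s + (p - eta))%:E <= dimH (power_set k.+1 F).
  apply: dim_ge_nnull; first exact: euclidean_dist_ge0.
  move=> /null_power_setS[]// h.
  have := dim_le_null (ltW pe) h; rewrite -/(dimH _) pE lee_fin; lra.
have up : dimH [set x | power_set k.+1 F x /\ affinely_dependent x]
    <= (p + eta + k.+1%:R)%:E.
  apply: dim_le_null; first by rewrite addr_ge0// ltW.
  apply: null_dependent => //; apply: null_dim_lt; first exact: euclidean_dist_ge0.
  by rewrite -/(dimH _) pE lte_fin; lra.
have h : dimH (power_set k.+1 F) <= (Num.max q (p + eta + k.+1%:R))%:E.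
  rewrite (_ : power_set k.+1 F = @independent_tuples R d k.+1 F `|`
     [set x | power_set k.+1 F x /\ affinely_dependent x]); last first.
    apply/seteqP; split => [x Fx|x [[]|[]]//].
    by have [|] := pselect (affinely_dependent x); [right|left].
  apply: dimH_setU_le; first by rewrite le_max q0.
    by rewrite qE lee_fin le_max lexx.
  by apply: le_trans up _; rewrite lee_fin le_max lexx orbT.
have [P P0 PE] := dimH_real (power_set k.+1 F).
move: low h; rewrite qE PE !lee_fin le_max => low /orP[//|h]; lra.
Qed.

End PowerSets.

(** * Affine subspaces: codes, powers, and their metric *)

Section OrthogonalProjection.
Context {R : realType}.
Local Open Scope ring_scope.

Lemma dot_self_eq0 n (v : 'rV[R]_n) : v *m v^T = 0 -> v = 0.
Proof.
move=> /matrixP/(_ ord0 ord0); rewrite !mxE => h; apply/rowP => i; rewrite mxE.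
have s0 j : true -> 0 <= v ord0 j * v^T j ord0 by rewrite mxE -expr2 sqr_ge0.
move/eqP: h; rewrite psumr_eq0// => /allP/(_ i).
by rewrite mem_index_enum mxE -expr2 sqrf_eq0 => /(_ isT)/eqP.
Qed.

Lemma sub_orth_compl m n (V : 'M[R]_(m, n)) (W : 'M[R]_n) :
  (V <= orth_compl W)%MS = (V *m W^T == 0).
Proof. exact: sub_kermx. Qed.

Lemma cap_orth_compl n (W : 'M[R]_n) : (W :&: orth_compl W)%MS = 0.
Proof.
apply/eqP; rewrite -submx0; apply/row_subP => i; set v := row i _.
have : (v <= W :&: orth_compl W)%MS by exact: row_sub.
rewrite sub_capmx sub_orth_compl => /andP[/submxP[u uW] /eqP v0].
rewrite (@dot_self_eq0 _ v) ?sub0mx//.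
by rewrite {2}uW trmx_mul mulmxA v0 mul0mx.
Qed.

Lemma add_orth_compl n (W : 'M[R]_n) : (1%:M <= W + orth_compl W)%MS.
Proof.
rewrite sub1mx -col_leq_rank mxrank_disjoint_sum ?cap_orth_compl//.
by rewrite mxrank_ker mxrank_tr subnKC// rank_leq_row.
Qed.

Lemma orth_proj_id m n (V : 'M[R]_(m, n)) (W : 'M[R]_n) :
  (V <= W)%MS -> V *m orth_proj W = V.
Proof. exact: proj_mx_id (cap_orth_compl W). Qed.

Lemma orth_proj_0 m n (V : 'M[R]_(m, n)) (W : 'M[R]_n) :
  (V <= orth_compl W)%MS -> V *m orth_proj W = 0.
Proof. exact: proj_mx_0 (cap_orth_compl W). Qed.

Lemma orth_proj_sub m n (V : 'M[R]_(m, n)) (W : 'M[R]_n) :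
  (V *m orth_proj W <= W)%MS.
Proof. exact: proj_mx_sub. Qed.

Lemma orth_proj_compl_sub m n (V : 'M[R]_(m, n)) (W : 'M[R]_n) :
  (V - V *m orth_proj W <= orth_compl W)%MS.
Proof.
apply: proj_mx_compl_sub; apply: submx_trans (submx1 _) (add_orth_compl W).
Qed.

(** The two equations prescribe the matrix on the row space of [W] and on its
    complement, which together span. *)
Lemma orth_proj_unique n (W P : 'M[R]_n) :
  W *m P = W -> orth_compl W *m P = 0 -> P = orth_proj W.
Proof.
move=> WP VP; have /sub_addsmxP[ab e] := add_orth_compl W.
rewrite -[LHS]mul1mx -[RHS]mul1mx e !mulmxDl -!(mulmxA ab.1) -!(mulmxA ab.2) WP VP.
by rewrite orth_proj_id// orth_proj_0.
Qed.

Lemma orth_proj_eqmx n (W : 'M[R]_n) : (orth_proj W :=: W)%MS.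
Proof.
apply/eqmxP; rewrite -{1}[orth_proj W]mul1mx orth_proj_sub/=.
by rewrite -{1}(orth_proj_id (submx_refl W)) submxMl.
Qed.

Lemma orth_compl_anti n (W W' : 'M[R]_n) :
  (W <= W')%MS -> (orth_compl W' <= orth_compl W)%MS.
Proof.
move=> /submxP[M ->]; rewrite sub_orth_compl trmx_mul mulmxA.
by rewrite (_ : orth_compl W' *m W'^T = 0) ?mul0mx// mulmx_ker.
Qed.

Lemma eq_orth_proj n (W W' : 'M[R]_n) : (W == W')%MS -> orth_proj W' = orth_proj W.
Proof.
move=> /andP[WW' W'W]; apply: orth_proj_unique; first exact: orth_proj_id.
by apply: orth_proj_0; exact: orth_compl_anti.
Qed.

End OrthogonalProjection.

Section AffineCodes.
Context {R : realType} {d : nat}.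
Local Open Scope ring_scope.
Implicit Types (W : 'M[R]_d) (p : 'rV[R]_d) (V : set 'rV[R]_d).

(** The direction is the set of differences of points of the flat, and two
    base points orthogonal to it differ by a vector that lies in it and is
    orthogonal to it. *)
Lemma flat_inj W W' p p' : (p <= orth_compl W)%MS -> (p' <= orth_compl W')%MS ->
  flat W p = flat W' p' -> (W == W')%MS /\ p = p'.
Proof.
move=> pW pW' e.
have half (U U' : 'M[R]_d) (q q' : 'rV[R]_d) : flat U q = flat U' q' ->
    (q - q' <= U')%MS /\ (U <= U')%MS.
  move=> eq; have h x : (x - q <= U)%MS -> (x - q' <= U')%MS.
    by move=> hx; have : flat U q x by []; rewrite eq.
  have qq : (q - q' <= U')%MS by apply: h; rewrite subrr sub0mx.
  split=> //; apply/row_subP => i; rewrite -[row i U](addrK (q - q')).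
  rewrite addmx_sub ?eqmx_opp// addrA; apply: h.
  by rewrite addrK row_sub.
have [pp WW'] := half _ _ _ _ e; have [_ W'W] := half _ _ _ _ (esym e).
split; first by rewrite WW' W'W.
apply/eqP; rewrite -subr_eq0 -submx0 -(cap_orth_compl W) sub_capmx.
rewrite (submx_trans pp W'W) addmx_sub// eqmx_opp.
exact: submx_trans pW' (orth_compl_anti WW').
Qed.

(** This is where the choice in the definition of the code is resolved: the
    specification has only one solution. *)
Lemma affine_code_flat W p : (p <= orth_compl W)%MS ->
  affine_code (flat W p) = (orth_proj W, p).
Proof.
move=> pW; rewrite /affine_code; set S := (X in xget _ X).
have : S !=set0 by exists (orth_proj W, p); exists W.
move=> /(xgetPex (0, 0)) [W' []]; case: (xget _ _) => c1 c2 /= e c2W' ->.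
by have [WW' ->] := flat_inj pW c2W' e; rewrite (eq_orth_proj WW').
Qed.

Lemma flat_normal W q : exists p,
  (p <= orth_compl W)%MS /\ flat W q = flat W p.
Proof.
exists (q - q *m orth_proj W); split; first exact: orth_proj_compl_sub.
apply/seteqP; split => x; rewrite /flat/= => h.
  by rewrite opprB addrCA addrC addmx_sub// orth_proj_sub.
have -> : x - q = x - (q - q *m orth_proj W) - q *m orth_proj W.
  by rewrite opprB addrA addrAC addrK.
by rewrite addmx_sub// eqmx_opp orth_proj_sub.
Qed.

Lemma affine_embed_inj W W' p p' :
  affine_embed (flat W p) = affine_embed (flat W' p') -> flat W p = flat W' p'.
Proof.
have [q [qW ->]] := flat_normal W p; have [q' [qW' ->]] := flat_normal W' p'.
rewrite /affine_embed !affine_code_flat//= => /eq_row_mx[/(can_inj mxvecK) e <-].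
apply/seteqP; split => x; rewrite /flat/= => h.
  by rewrite -(orth_proj_eqmx W') -e (orth_proj_eqmx W).
by rewrite -(orth_proj_eqmx W) e (orth_proj_eqmx W').
Qed.

(** The direction is the image of the coefficient vectors with sum 0, and any
    of the points serves as base point. *)
Lemma affine_span_flat k (x : 'rV[R]_(k.+1 * d)) :
  exists W p, affine_span x = flat W p.
Proof.
pose K := kermx (const_mx 1 : 'cV[R]_k.+1).
have KE (c : 'rV[R]_k.+1) : (c <= K)%MS = (\sum_i c ord0 i == 0).
  rewrite sub_kermx; apply/eqP/eqP => [/matrixP/(_ ord0 ord0)|h].
    rewrite !mxE => h; rewrite -[RHS]h.
    by apply: eq_bigr => i _; rewrite mxE mulr1.
  apply/matrixP => i j; rewrite !ord1 !mxE -[RHS]h.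
  by apply: eq_bigr => l _; rewrite mxE mulr1.
have e0 : \sum_i (delta_mx 0 0 : 'rV[R]_k.+1) ord0 i = 1.
  rewrite (bigD1 ord0)//= mxE/= big1 ?addr0// => i /negbTE i0.
  by rewrite mxE i0 andbF.
exists <<K *m vec_mx x>>%MS, (row 0 (vec_mx x)).
apply/seteqP; split => [_ [c /= c1 <-]|y]; rewrite /flat/= genmxE rowE.
  rewrite -mulmxBl submxMr// KE.
  have -> : \sum_i (c - delta_mx 0 0) ord0 i
      = \sum_i c ord0 i - \sum_i (delta_mx 0 0 : 'rV[R]_k.+1) ord0 i.
    by rewrite -sumrB; apply: eq_bigr => i _; rewrite !mxE.
  by rewrite c1 e0 subrr.
move=> /submxP[u hu]; exists (u *m K + delta_mx 0 0); last first.
  by rewrite mulmxDl -mulmxA -hu subrK.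
have : (u *m K <= K)%MS by exact: submxMl.
rewrite KE => /eqP uK /=.
by under eq_bigr do rewrite mxE; rewrite big_split/= uK e0 add0r.
Qed.

End AffineCodes.

Section PowersOfFlats.
Context {R : realType} {d k : nat}.
Local Open Scope ring_scope.
Implicit Types (W P : 'M[R]_d) (p : 'rV[R]_d).

(** The block diagonal matrix with [k.+1] copies of [W], in the ordering of
    coordinates used for flattened matrices: it acts on a flattened matrix by
    multiplying the matrix by [W] on the right. *)
Definition diag_blocks W : 'M[R]_(k.+1 * d) := lin_mx (@mulmxr R k.+1 d d W).

Definition repeat_row p : 'rV[R]_(k.+1 * d) := mxvec (\matrix_(i < k.+1) p).

Lemma mul_diag_blocks (x : 'rV[R]_(k.+1 * d)) W :
  x *m diag_blocks W = mxvec (vec_mx x *m W).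
Proof. by rewrite mul_rV_lin. Qed.

Lemma diag_blocksE W i j i' j' :
  diag_blocks W (mxvec_index i j) (mxvec_index i' j') = W j j' *+ (i == i').
Proof.
have -> : diag_blocks W (mxvec_index i j) (mxvec_index i' j')
    = row (mxvec_index i j) (diag_blocks W) ord0 (mxvec_index i' j') by rewrite [RHS]mxE.
rewrite rowE mul_diag_blocks vec_mx_delta mxvecE mxE (bigD1 j)//= big1 ?addr0.
  by rewrite mxE eqxx andbT mulr_natl eq_sym.
by move=> l /negbTE lj; rewrite mxE lj andbF mul0r.
Qed.

Lemma trmx_diag_blocks W : (diag_blocks W)^T = diag_blocks W^T.
Proof.
apply/matrixP => a b; rewrite mxE.
case/mxvec_indexP: a => i j; case/mxvec_indexP: b => i' j'.
by rewrite !diag_blocksE mxE eq_sym.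
Qed.

Lemma sub_diag_blocks (x : 'rV[R]_(k.+1 * d)) W :
  (x <= diag_blocks W)%MS = (vec_mx x <= W)%MS.
Proof.
apply/submxP/submxP => -[u].
  by rewrite mul_diag_blocks => ->; exists (vec_mx u); rewrite mxvecK.
move=> h; exists (mxvec u); rewrite mul_diag_blocks mxvecK -h.
by rewrite vec_mxK.
Qed.

Lemma power_set_flat W p :
  power_set k (flat W p) = flat (diag_blocks W) (repeat_row p).
Proof.
have rowB (x : 'rV[R]_(k.+1 * d)) i :
    row i (vec_mx (x - repeat_row p)) = row i (vec_mx x) - p.
  by rewrite linearB/= mxvecK linearB/= rowK.
apply/seteqP; split => x; rewrite /flat /power_set/= sub_diag_blocks.
  by move=> h; apply/row_subP => i; rewrite rowB; exact: h.
by move=> /row_subP h i; rewrite -rowB.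
Qed.

Lemma sub_orth_compl_diag_blocks (x : 'rV[R]_(k.+1 * d)) W :
  (x <= orth_compl (diag_blocks W))%MS = (vec_mx x <= orth_compl W)%MS.
Proof.
rewrite !sub_orth_compl trmx_diag_blocks mul_diag_blocks.
by rewrite -(inj_eq (can_inj vec_mxK)) mxvecK linear0.
Qed.

(** Both the row space and the orthogonal complement of the block matrix are
    read off row by row, so the block matrix of the projection satisfies the
    equations that characterise the projection. *)
Lemma orth_proj_diag_blocks W : orth_proj (diag_blocks W) = diag_blocks (orth_proj W).
Proof.
apply/esym/orth_proj_unique; apply/row_matrixP => i; rewrite row_mul.
  have : (row i (diag_blocks W) <= diag_blocks W)%MS by exact: row_sub.
  rewrite sub_diag_blocks mul_diag_blocks => h.
  by rewrite orth_proj_id// vec_mxK.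
have : (row i (orth_compl (diag_blocks W)) <= orth_compl (diag_blocks W))%MS.
  exact: row_sub.
rewrite sub_orth_compl_diag_blocks mul_diag_blocks => h.
by rewrite orth_proj_0// linear0 row0.
Qed.

Lemma affine_code_power W p : (p <= orth_compl W)%MS ->
  affine_code (power_set k (flat W p)) = (diag_blocks (orth_proj W), repeat_row p).
Proof.
move=> pW; rewrite power_set_flat affine_code_flat ?orth_proj_diag_blocks//.
rewrite sub_orth_compl_diag_blocks mxvecK.
by apply/row_subP => i; rewrite rowK.
Qed.

End PowersOfFlats.

Section AffineDistance.
Context {R : realType} {d : nat}.
Local Open Scope ring_scope.
Implicit Types (V : set 'rV[R]_d) (M : 'M[R]_d).

Let ball0 M : [set enorm (v *m M) | v in [set v : 'rV[R]_d | enorm v <= 1]] !=set0.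
Proof.
exists (enorm (0 *m M)), 0 => //=; rewrite (_ : enorm 0 = 0) ?ler01//.
apply/eqP; rewrite eq_le enorm_ge0 andbT.
have := @enorm_le R d 0 0 (lexx _); rewrite mulr0; apply => i.
by rewrite mxE normr0.
Qed.

Let enorm_mul M r (v : 'rV[R]_d) : 0 <= r -> (forall i j, `|M i j| <= r) ->
  enorm v <= 1 -> enorm (v *m M) <= d%:R * (d%:R * r).
Proof.
move=> r0 hM v1; apply: enorm_le => [|j]; first by rewrite mulr_ge0.
rewrite mxE; apply: le_trans (ler_norm_sum _ _ _) _.
apply: (@le_trans _ _ (\sum_(i < d) r)).
  apply: ler_sum => i _; rewrite normrM -[leRHS]mul1r ler_pM//.
  exact: le_trans (coord_le_enorm v i) v1.
by rewrite sumr_const card_ord -[leLHS]mulr_natl.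
Qed.

Lemma opnorm_le M r : 0 <= r -> (forall i j, `|M i j| <= r) ->
  opnorm M <= d%:R * (d%:R * r).
Proof.
move=> r0 hM; apply: ge_sup; first exact: ball0.
by move=> _ [v /= v1 <-]; exact: enorm_mul.
Qed.

Let entries_bounded M : exists2 r, 0 <= r & forall i j, `|M i j| <= r.
Proof.
exists (\sum_a \sum_b `|M a b|) => [|i j].
  by rewrite sumr_ge0// => a _; rewrite sumr_ge0.
rewrite (bigD1 i)//= (bigD1 j)//= -addrA lerDl addr_ge0// sumr_ge0// => c _.
by rewrite sumr_ge0.
Qed.

Lemma entry_le_opnorm M i j : `|M i j| <= opnorm M.
Proof.
have [r r0 hr] := entries_bounded M.
have e1 : enorm (delta_mx 0 i : 'rV[R]_d) <= 1.
  rewrite /enorm (bigD1 i)//= big1 ?addr0 => [|l /negbTE li].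
    by rewrite mxE !eqxx expr1n sqrtr1.
  by rewrite mxE li andbF expr0n.
apply: (@le_trans _ _ (enorm (delta_mx 0 i *m M))).
  by have := coord_le_enorm (delta_mx 0 i *m M) j; rewrite -rowE mxE.
apply: ub_le_sup; last by exists (delta_mx 0 i).
exists (d%:R * (d%:R * r)) => _ [v /= v1 <-]; exact: enorm_mul.
Qed.

Lemma opnorm_ge0 M : 0 <= opnorm M.
Proof.
have [z [v v1 vz]] := ball0 M.
apply: le_trans (enorm_ge0 (v *m M)) _.
have [r r0 hr] := entries_bounded M.
apply: ub_le_sup; last by exists v.
exists (d%:R * (d%:R * r)) => _ [w /= w1 <-]; exact: enorm_mul.
Qed.

Lemma affine_dist_ge0 V V' : 0 <= affine_dist V V'.
Proof. by rewrite addr_ge0 ?opnorm_ge0 ?enorm_ge0. Qed.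

Lemma direction_le_affine_dist V V' i j :
  `|(affine_code V).1 i j - (affine_code V').1 i j| <= affine_dist V V'.
Proof.
have := entry_le_opnorm ((affine_code V).1 - (affine_code V').1) i j.
rewrite !mxE => /le_trans; apply.
by rewrite /affine_dist lerDl enorm_ge0.
Qed.

Lemma offset_le_affine_dist V V' i :
  `|(affine_code V).2 ord0 i - (affine_code V').2 ord0 i| <= affine_dist V V'.
Proof.
have := coord_le_enorm ((affine_code V).2 - (affine_code V').2) i.
rewrite !mxE => /le_trans; apply.
by rewrite /affine_dist lerDr opnorm_ge0.
Qed.

Lemma affine_dist_le V V' r : 0 <= r ->
  (forall i j, `|(affine_code V).1 i j - (affine_code V').1 i j| <= r) ->
  (forall i, `|(affine_code V).2 ord0 i - (affine_code V').2 ord0 i| <= r) ->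
  affine_dist V V' <= (d%:R * d%:R + d%:R) * r.
Proof.
move=> r0 h1 h2; rewrite mulrDl -mulrA; apply: lerD.
  by apply: opnorm_le => // i j; rewrite !mxE.
by apply: enorm_le => // i; rewrite !mxE.
Qed.

Lemma euclidean_dist_embed_le V V' :
  euclidean_dist (affine_embed V) (affine_embed V')
  <= (d * d + d)%:R * affine_dist V V'.
Proof.
apply: euclidean_dist_le => [|i]; first exact: affine_dist_ge0.
rewrite /affine_embed; case: (split_ordP i) => j ->.
  rewrite !row_mxEl; case/mxvec_indexP: j => a b; rewrite !mxvecE.
  exact: direction_le_affine_dist.
by rewrite !row_mxEr; exact: offset_le_affine_dist.
Qed.

Lemma affine_dist_le_embed V V' :
  affine_dist V V' <=
  (d%:R * d%:R + d%:R) * euclidean_dist (affine_embed V) (affine_embed V').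
Proof.
apply: affine_dist_le => [|i j|i]; first exact: euclidean_dist_ge0.
  have := coord_le_dist (affine_embed V) (affine_embed V')
    (lshift d (mxvec_index i j)).
  by rewrite !row_mxEl !mxvecE.
have := coord_le_dist (affine_embed V) (affine_embed V') (rshift (d * d) i).
by rewrite !row_mxEr.
Qed.

End AffineDistance.

Section PowerDistance.
Context {R : realType} {d k : nat}.
Local Open Scope ring_scope.
Variables (V V' : set 'rV[R]_d).
Hypothesis flatV : exists W p, V = flat W p.
Hypothesis flatV' : exists W p, V' = flat W p.

Lemma affine_dist_power_le :
  affine_dist (power_set k V) (power_set k V') <=
  ((k.+1 * d)%:R * (k.+1 * d)%:R + (k.+1 * d)%:R) * affine_dist V V'.
Proof.
have [W [q ->]] := flatV; have [W' [q' ->]] := flatV'.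
have [p [pW ->]] := flat_normal W q; have [p' [pW' ->]] := flat_normal W' q'.
have D0 := affine_dist_ge0 (flat W p) (flat W' p').
apply: affine_dist_le => // [a b|a]; rewrite !affine_code_power//=.
  case/mxvec_indexP: a => i j; case/mxvec_indexP: b => i' j'.
  rewrite !diag_blocksE; case: (i == i'); last by rewrite subr0 normr0.
  have := direction_le_affine_dist (flat W p) (flat W' p') j j'.
  by rewrite !affine_code_flat.
case/mxvec_indexP: a => i j; rewrite !mxvecE !mxE.
have := offset_le_affine_dist (flat W p) (flat W' p') j.
by rewrite !affine_code_flat.
Qed.

(** The entries of the code of a plane are among those of the code of its
    power: look at the first block. *)
Lemma affine_dist_le_power :
  affine_dist V V' <=
  (d%:R * d%:R + d%:R) * affine_dist (power_set k V) (power_set k V').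
Proof.
have [W [q ->]] := flatV; have [W' [q' ->]] := flatV'.
have [p [pW ->]] := flat_normal W q; have [p' [pW' ->]] := flat_normal W' q'.
have h1 := direction_le_affine_dist (power_set k (flat W p)) (power_set k (flat W' p')).
have h2 := offset_le_affine_dist (power_set k (flat W p)) (power_set k (flat W' p')).
apply: affine_dist_le => [|i j|i]; first exact: affine_dist_ge0.
  rewrite !affine_code_flat//=; have := h1 (mxvec_index ord0 i) (mxvec_index ord0 j).
  by rewrite !affine_code_power//= !diag_blocksE.
rewrite !affine_code_flat//=; have := h2 (mxvec_index ord0 i).
by rewrite !affine_code_power//= !mxvecE !mxE.
Qed.

End PowerDistance.

(** * Effective dimension, incidences, and the essential supremum *)

Section DimensionOfFlats.
Context {R : realType}.

Lemma dimH_image m1 m2 (h : 'rV[R]_m1 -> 'rV[R]_m2) (Z : set 'rV[R]_m1) (L : R) :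
  (0 < L)%R ->
  (forall x y j, Z x -> Z y ->
     `|h x ord0 j - h y ord0 j| <= L * euclidean_dist x y)%R ->
  dimH (h @` Z) <= dimH Z.
Proof.
move=> L0 hL; apply: le_ereal_inf_tmp => _ [t [t0 Zt] <-].
by apply: dim_le_null => //; exact: (null_image t0 L0 hL).
Qed.

Lemma dimH_flat_le d (W : 'M[R]_d) (p : 'rV[R]_d) :
  dimH (flat W p) <= (\rank W)%:R%:E.
Proof.
pose h (u : 'rV[R]_(\rank W)) := (p + u *m row_base W)%R.
have -> : flat W p = h @` setT.
  apply/seteqP; split => [x|_ [u _ <-]]; rewrite /flat/=.
    rewrite -(eq_row_base W) => /submxP[u hu]; exists u => //.
    by rewrite /h -hu addrC subrK.
  by rewrite /h addrAC subrr add0r -(eq_row_base W) submxMl.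
apply: le_trans (dimH_le [set: 'rV[R]_(\rank W)]).
pose L : R := (1 + \sum_i \sum_j `|row_base W i j|)%R.
have s0 i : (0 <= \sum_j `|row_base W i j|)%R by rewrite sumr_ge0.
apply: (@dimH_image _ _ _ _ L) => [|x y j _ _].
  by rewrite ltr_wpDr// sumr_ge0.
rewrite !mxE opprD addrACA subrr add0r -sumrB.
apply: le_trans (ler_norm_sum _ _ _) _.
rewrite mulrDl mul1r; apply: ler_wpDl; first exact: euclidean_dist_ge0.
rewrite mulr_suml; apply: ler_sum => i _; rewrite -mulrBl normrM mulrC.
apply: ler_pM => //; last exact: coord_le_dist.
by rewrite (bigD1 j)//= lerDl sumr_ge0.
Qed.

(** The dimension of [E] is the larger of the dimensions of its two parts, and
    the part outside [V] falls short of it. *)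
Lemma dimH_setI_of_setD d (E V : set 'rV[R]_d) :
  dimH (E `\` V) < dimH E -> dimH E <= dimH (E `&` V).
Proof.
have [a a0 aE] := dimH_real (E `&` V); have [b b0 bE] := dimH_real (E `\` V).
have [c c0 cE] := dimH_real E; rewrite aE bE cE lte_fin lee_fin => bc.
have : dimH E <= (Num.max a b)%:E.
  rewrite -{1}(setIT E) -(setUv V) setIUr.
  apply: dimH_setU_le; first by rewrite le_max a0.
    by rewrite aE lee_fin le_max lexx.
  by rewrite -setDE bE lee_fin le_max lexx orbT.
by rewrite cE lee_fin le_max => /orP[//|]; rewrite leNgt bc.
Qed.

(** The whole space shows that the minimum exists and is at most [d].  For the
    lower bound, a plane that carries the dimension of [E] has dimension at
    least that of [E], which exceeds [k]. *)
Lemma effective_dim_bounds d k (E : set 'rV[R]_d) :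
  k%:R%:E < dimH E -> (k.+1 <= effective_dim E <= d)%N.
Proof.
move=> kE; rewrite /effective_dim.
pose drops m := exists V, @affine_grass R d m V /\ dimH (E `\` V) < dimH E.
have dd : drops d.
  exists setT; split; last first.
    rewrite setDT /dimH dim_set0.
    by apply: le_lt_trans kE; rewrite lee_fin.
  exists 1%:M%R, 0%R; split; first by rewrite mxrank1.
  by apply/esym/seteqP; split => // x _; rewrite /flat/= submx1.
have lower m : drops m -> (k < m)%N.
  move=> [V [[W [p [Wm Vp]]] VE]]; rewrite ltnNge; apply/negP => mk.
  have := dimH_setI_of_setD VE; apply/negP; rewrite -ltNge.
  apply: le_lt_trans kE; apply: (@le_trans _ _ (dimH V)).
    by apply: dim_mono => x [].
  rewrite Vp; apply: le_trans (dimH_flat_le _ _) _.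
  by rewrite Wm lee_fin ler_nat.
have ex : exists m, `[< drops m >] by exists d; apply/asboolP.
have [m /asboolP dm mmin] := ex_minnP ex.
set S := (X in xget _ X).
have : S !=set0.
  by exists m; split => // n dn; apply: mmin; apply/asboolP.
by move=> /(xgetPex 0%N) [dr mn]; rewrite lower//= mn.
Qed.

End DimensionOfFlats.

Section EssentialSupremum.
Context {R : realType}.

Lemma measure_gt0P (T : Type) (dist : T -> T -> R) t (A : set T) :
  0 < hausdorff_measure dist t A <-> hausdorff_measure dist t A <> 0.
Proof.
have h := hausdorff_measure_ge0 dist t A.
by rewrite lt_neqAle h andbT eq_sym; split => [/eqP|/eqP].
Qed.

Lemma sup_levels_anti (T : Type) (dist : T -> T -> R) (Z : set T)
    (f : T -> \bar R) (t t' : R) :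
  (forall x y, (0 <= dist x y)%R) -> (0 <= t)%R -> (t <= t')%R ->
  sup_levels dist t' Z f <= sup_levels dist t Z f.
Proof.
move=> d0 t0 tt'; rewrite /sup_levels ge_max le_max lexx/= le_max.
apply/orP; right; apply: ge_ereal_sup => _ [q [q0 hq] <-].
apply: ereal_sup_ubound; exists q => //; split => //.
by apply/measure_gt0P => h; move/measure_gt0P: hq; apply; exact: (null_anti d0 t0 tt' h).
Qed.

Context {X T1 T2 : Type}.
Variables (dist1 : T1 -> T1 -> R) (dist2 : T2 -> T2 -> R).
Hypothesis dist1_ge0 : forall x y, (0 <= dist1 x y)%R.
Hypothesis dist2_ge0 : forall x y, (0 <= dist2 x y)%R.
Variables (h1 : X -> T1) (h2 : X -> T2) (Z : set X) (L1 L2 : R).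
Hypothesis Z0 : Z !=set0.
Hypothesis L10 : (0 < L1)%R.
Hypothesis L20 : (0 < L2)%R.
Hypothesis lip1 : forall x y, Z x -> Z y ->
  (dist1 (h1 x) (h1 y) <= L1 * dist2 (h2 x) (h2 y))%R.
Hypothesis lip2 : forall x y, Z x -> Z y ->
  (dist2 (h2 x) (h2 y) <= L2 * dist1 (h1 x) (h1 y))%R.
Variables (f1 : T1 -> \bar R) (f2 : T2 -> \bar R).
Hypothesis f12 : forall x, Z x -> f1 (h1 x) <= f2 (h2 x).

Lemma sup_levels_transfer t : (0 <= t)%R ->
  sup_levels dist1 t (h1 @` Z) f1 <= sup_levels dist2 t (h2 @` Z) f2.
Proof.
move=> t0; rewrite /sup_levels ge_max le_max lexx/= le_max.
apply/orP; right; apply: ge_ereal_sup => _ [q [q0 hq] <-].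
apply: ereal_sup_ubound; exists q => //; split => //.
apply/measure_gt0P => h; move/measure_gt0P: hq; apply.
pose Y := [set x | Z x /\ q%:E < f1 (h1 x)].
have -> : [set z | (h1 @` Z) z /\ q%:E < f1 z] = h1 @` Y.
  apply/seteqP; split => [_ [[x Zx <-] qx]|_ [x [Zx qx] <-]]; first by exists x.
  by split => //; exists x.
apply: (null_transfer dist2_ge0 dist1_ge0 (h1 := h2) L10) => //.
  by move=> x y [Zx _] [Zy _]; exact: lip1.
apply: null_subset h => _ [x [Zx qx] <-]; split; first by exists x.
exact: lt_le_trans (f12 Zx).
Qed.

(** Superlevel sets transfer at each exponent.  If the measure at [alpha]
    vanishes then [alpha] is positive, since [Z] is nonempty, and the levels
    are monotone in the exponent; the limits then exist and are infima, which
    can be compared termwise. *)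
Lemma ess_sup_dim_transfer (alpha : R) : (0 <= alpha)%R ->
  ess_sup_dim dist1 alpha (h1 @` Z) f1 <= ess_sup_dim dist2 alpha (h2 @` Z) f2.
Proof.
move=> a0; rewrite /ess_sup_dim.
have eqH : `[< 0 < hausdorff_measure dist1 alpha (h1 @` Z) >]
    = `[< 0 < hausdorff_measure dist2 alpha (h2 @` Z) >].
  by apply/asbool_equiv_eq; split => /measure_gt0P h; apply/measure_gt0P => h';
    apply: h; [exact: (null_transfer dist2_ge0 dist1_ge0 L10 lip1)|
               exact: (null_transfer dist1_ge0 dist2_ge0 L20 lip2)].
rewrite eqH; case: asboolP => [_|/measure_gt0P]; first exact: sup_levels_transfer.
move=> /contrapT hn; have ap : (0 < alpha)%R.
  rewrite lt_neqAle a0 andbT; apply/eqP => a0'.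
  move: hn; rewrite -a0' => /null0_eq0 h.
  by case: Z0 => x Zx; have : (h2 @` Z) (h2 x); [exists x|rewrite h].
have limE (T : Type) (dist : T -> T -> R) (S : set T) (f : T -> \bar R) :
    (forall x y, (0 <= dist x y)%R) ->
    lim (sup_levels dist (alpha - eps) S f @[eps --> (0 : R)^'+]) =
    ereal_inf [set sup_levels dist (alpha - eps)%R S f | eps in `]0%R, alpha[%classic].
  move=> d0; apply/cvg_lim => //; apply: nondecreasing_at_right_cvge.
    by rewrite bnd_simp.
  move=> x y; rewrite !in_itv/= => /andP[x0 xa] /andP[y0 ya] xy.
  by apply: sup_levels_anti => //; lra.
rewrite !limE//; apply: le_ereal_inf_tmp => _ [e /= he <-].
apply: (@le_trans _ _ (sup_levels dist1 (alpha - e) (h1 @` Z) f1)).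
  by apply: ereal_inf_lbound; exists e.
by apply: sup_levels_transfer; move: he; rewrite in_itv/=; lra.
Qed.

End EssentialSupremum.

Section Incidence.
Context {R : realType} {d k : nat}.
Variable F : set 'rV[R]_d.
Local Notation P := (spanned_planes k F).
Local Notation S := (incidence_set k F).

Let flatP W : P W -> exists W0 p, W = flat W0 p.
Proof. by move=> [x _ <-]; exact: affine_span_flat. Qed.

Lemma power_set_affine_span (x : 'rV[R]_(k.+1 * d)) :
  power_set k (affine_span x) x.
Proof.
move=> i; exists (delta_mx 0 i)%R; last by rewrite -rowE.
rewrite /= (bigD1 i)//= big1 ?addr0 => [|l /negbTE li].
  by rewrite mxE !eqxx.
by rewrite mxE li andbF.
Qed.

Lemma projection_incidence : [set lsubmx b | b in S] = @affine_embed R d @` P.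
Proof.
apply/seteqP; split => [_ [_ [x Fx <-] <-]|_ [_ [x Fx <-] <-]].
  by exists (affine_span x); rewrite ?row_mxKl//; exists x.
exists (row_mx (affine_embed (affine_span x)) x); last by rewrite row_mxKl.
by exists x.
Qed.

Let dpos : (0 < d%:R * d%:R + d%:R + 1 :> R)%R.
Proof. by rewrite ltr_wpDl// addr_ge0// mulr_ge0. Qed.

Let embed_le (V V' : set 'rV[R]_d) : (euclidean_dist (affine_embed V) (affine_embed V') <=
  (d%:R * d%:R + d%:R + 1 : R) * affine_dist V V')%R.
Proof.
apply: le_trans (euclidean_dist_embed_le _ _) _.
by rewrite ler_wpM2r ?affine_dist_ge0// natrD natrM lerDl.
Qed.

Let le_embed (V V' : set 'rV[R]_d) : (affine_dist V V' <=
  (d%:R * d%:R + d%:R + 1 : R) * euclidean_dist (affine_embed V) (affine_embed V'))%R.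
Proof.
apply: le_trans (affine_dist_le_embed _ _) _.
by rewrite ler_wpM2r ?euclidean_dist_ge0// lerDl.
Qed.

Lemma dimH_projection_incidence :
  dimH [set lsubmx b | b in S] = dimH_affine P.
Proof.
rewrite projection_incidence /dimH_affine -{2}(image_id P).
apply/eqP; rewrite eq_le; apply/andP; split.
  by apply: (dim_transfer (h1 := id) _ _ dpos) => *;
    rewrite ?euclidean_dist_ge0 ?affine_dist_ge0.
by apply: (dim_transfer (h2 := id) _ _ dpos) => *;
  rewrite ?euclidean_dist_ge0 ?affine_dist_ge0.
Qed.

Lemma dimH_incidence_ge : dimH (@independent_tuples R d k F) <= dimH S.
Proof.
have -> : @independent_tuples R d k F = rsubmx @` S.
  apply/seteqP; split => [x Fx|_ [_ [x Fx <-] <-]]; last by rewrite row_mxKr.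
  exists (row_mx (affine_embed (affine_span x)) x); last by rewrite row_mxKr.
  by exists x.
apply: (dimH_image ltr01) => x y j _ _; rewrite mul1r !mxE.
exact: coord_le_dist.
Qed.

(** Codes separate planes, so a tuple over the code of [W] spans [W] itself
    and therefore has its points in [W]. *)
Lemma dimH_fibre_le W : P W ->
  dimH [set b | S b /\ lsubmx b = affine_embed W]
  <= dimH (power_set k F `&` power_set k W).
Proof.
move=> PW; apply: (@le_trans _ _ (dimH
    (row_mx (affine_embed W) @` (power_set k F `&` power_set k W)))).
  apply: dim_mono => _ [[x [Fx _] <-]]; rewrite row_mxKl => e.
  exists x; last by rewrite e.
  split => //; have [W0 [p WE]] := flatP PW.
  have [W1 [p1 xE]] := affine_span_flat x.
  rewrite WE xE in e; rewrite WE -(affine_embed_inj e) -xE.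
  exact: power_set_affine_span.
apply: (dimH_image ltr01) => x y j _ _; rewrite mul1r.
case: (split_ordP j) => i ->; rewrite ?row_mxEl ?row_mxEr.
  by rewrite subrr normr0 euclidean_dist_ge0.
exact: coord_le_dist.
Qed.

Lemma ess_sup_fibres_le (beta : R) : (0 <= beta)%R -> P !=set0 ->
  ess_sup_dim (@euclidean_dist R (d * d + d)) beta [set lsubmx b | b in S]
    (fun x => dimH [set b | S b /\ lsubmx b = x])
  <= ess_sup_dim (@affine_dist R (k.+1 * d)) beta (spanned_plane_powers k F)
    (fun Wk => dimH (power_set k F `&` Wk)).
Proof.
move=> b0 P0; rewrite projection_incidence.
pose c n : R := (n%:R * n%:R + n%:R + 1)%R.
have c0 n : (0 < c n)%R by rewrite ltr_wpDl// addr_ge0// mulr_ge0.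
have c1 n : (n%:R * n%:R + n%:R <= c n)%R by rewrite lerDl.
apply: (@ess_sup_dim_transfer _ _ _ _ _ _ _ _ _ (power_set k) P
   (c d * c d)%R (c (k.+1 * d)%N * c d)%R) => //.
- exact: euclidean_dist_ge0.
- exact: affine_dist_ge0.
- by rewrite mulr_gt0.
- by rewrite mulr_gt0.
- move=> V V' PV PV'; apply: le_trans (embed_le _ _) _.
  rewrite -mulrA; apply: ler_wpM2l; first exact: ltW.
  apply: le_trans (@affine_dist_le_power R d k _ _ (flatP PV) (flatP PV')) _.
  by rewrite ler_wpM2r ?affine_dist_ge0.
- move=> V V' PV PV'.
  apply: le_trans (@affine_dist_power_le R d k _ _ (flatP PV) (flatP PV')) _.
  rewrite -mulrA; apply: ler_pM; rewrite ?c1 ?le_embed//.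
  exact: affine_dist_ge0.
- by move=> V PV; exact: dimH_fibre_le.
Qed.

End Incidence.

Theorem corollary1p11 (R : realType) (d k : nat) (E : set 'rV[R]_d) (s : R)
  (hd : (2 <= d)%N) (hk : (1 <= k)%N) (hE : borel E)
  (hdim : s%:E < dimH E) (hs : (k%:R < s)%R) :
  (k.+1 <= effective_dim E <= d)%N /\
  forall V : set 'rV[R]_d,
    affine_grass (effective_dim E) V ->
    dimH (E `\` V) < dimH E ->
    let dE := effective_dim E in
    let F := E `&` V in
    fubini_property (incidence_set k F) ->
    ess_sup_dim (@affine_dist R (k.+1 * d)%N)
      (fine (dimH_affine (spanned_planes k F))) (spanned_plane_powers k F)
      (fun Wk => dimH (power_set k F `&` Wk))
    <= maxe 0 (dimH (power_set k F)
               - ((k.+1)%:R * (dE%:R - k%:R) : R)%:E) ->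
    dimH_affine (spanned_planes k F) <= dimH_affine (spanned_planes k E) /\
    ((k.+1)%:R * Num.min s (dE%:R - k%:R) : R)%:E
      <= dimH_affine (spanned_planes k F).
Proof.
split.
  by apply: effective_dim_bounds; apply: lt_trans hdim; rewrite lte_fin.
move=> V _ VE dE F [[_ [x0 Fx0 _]] dimS] ess; split.
  apply: dim_mono => _ [x [Fx nx] <-]; exists x => //; split => // i.
  by case: (Fx i).
have s0 : (0 < s)%R by apply: le_lt_trans hs.
have sF : s%:E < dimH F := lt_le_trans hdim (dimH_setI_of_setD VE).
have [p p0 pE] := dimH_real (power_set k F).
have [b b0 bE] := dimH_real [set lsubmx x | x in incidence_set k F].
have bP := @dimH_projection_incidence R d k F.
have sp : (k.+1%:R * s <= p)%R.
  by rewrite -lee_fin -pE; exact: dimH_power_set_ge.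
have fine_b : fine (dimH_affine (spanned_planes k F)) = b by rewrite -bP bE.
rewrite bE in dimS; rewrite fine_b in ess.
have P0 : spanned_planes k F !=set0 by exists (affine_span x0), x0.
have fibres := le_trans (ess_sup_fibres_le b0 P0) ess.
(* Remove the dependent tuples, project the incidence set onto the rest, then
   apply the Fubini property and bound its fibres by the hypothesis on the
   powers of the planes. *)
have : dimH (power_set k F) <= b%:E + maxe 0 (dimH (power_set k F)
               - ((k.+1)%:R * (dE%:R - k%:R) : R)%:E).
  apply: le_trans (dimH_independent_tuples hk hs sF) _.
  apply: le_trans (dimH_incidence_ge F) _.
  rewrite dimS; apply: leeD2l; exact: fibres.
rewrite -bP bE pE -EFinB -EFin_max -EFinD !lee_fin.
move: (dE%:R - k%:R)%R => c.
have k0 : (0 <= k.+1%:R :> R)%R by [].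
have ms : (k.+1%:R * Num.min s c <= k.+1%:R * s)%R.
  by rewrite ler_wpM2l// ge_min lexx.
have mc : (k.+1%:R * Num.min s c <= k.+1%:R * c)%R.
  by rewrite ler_wpM2l// ge_min lexx orbT.
move: sp ms mc; move: (_ * Num.min s c)%R (_ * s)%R (_ * c)%R => u v w.
by case: (leP (0 : R)%R (p - w)%R) => _; lra.
Qed.
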